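(* Let $G=SL(n,\mathbb C)$, let $T\subseteq B\subseteq G$ be a maximal torus and a Borel subgroup, let $\alpha_0=\omega_1+\omega_{n-1}$ be the highest root and $P=P_1\cap P_{n-1}\supseteq B$ the corresponding parabolic subgroup. Let $w\in W^P$ be such that $X_P(w)^{ss}_T(\mathcal L_{\alpha_0})$ is nonempty, and let $\mathcal M$ be the descent of $\mathcal L_{\alpha_0}$ to the GIT quotient $X_P(w)^{ss}_T(\mathcal L_{\alpha_0})/\!/T$. Then the polarized variety $(X_P(w)^{ss}_T(\mathcal L_{\alpha_0})/\!/T,\ \mathcal M)$ is projectively normal.
   Context: $P_r$ denotes the maximal parabolic subgroup containing $B$ associated to the simple root $\alpha_r$ (so $G/P_r=Gr(r,n)$), and $\omega_i$ are the fundamental weights. $W=S_n$ is the Weyl group and $W^P$ the set of minimal length representatives of $W/W_P$; $X_P(w)=\overline{BwP/P}\subset G/P$ is the Schubert variety. $\mathcal L_{\alpha_0}$ is the (very ample) homogeneous line bundle on $G/P$ associated to $\alpha_0$, with $H^0(G/P,\mathcal L_{\alpha_0})\cong V(\alpha_0)^*$, with its natural $G$-linearization, restricted to $X_P(w)$. $X_P(w)^{ss}_T(\mathcal L_{\alpha_0})$ is the set of $x\in X_P(w)$ such that some $T$-invariant section of some power $\mathcal L_{\alpha_0}^m$, $m\geq 1$, on $X_P(w)$ does not vanish at $x$. The GIT quotient is $\mathrm{Proj}\big(\bigoplus_{m\ge 0}H^0(X_P(w),\mathcal L_{m\alpha_0})^T\big)$. Since $\alpha_0$ lies in the root lattice,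 $\mathcal L_{\alpha_0}$ descends to the quotient (Kumar), i.e. there is a line bundle $\mathcal M$ on the quotient whose pullback to the semistable locus is $\mathcal L_{\alpha_0}$ ($T$-equivariantly). A polarized projective variety $(Y,\mathcal M)$ is projectively normal if the graded ring $\bigoplus_{m\ge0}H^0(Y,\mathcal M^{m})$ is normal and generated as a $\mathbb C$-algebra by $H^0(Y,\mathcal M)$. *)

(* Defs.v *)
From HB Require Import structures.
From mathcomp Require Import all_boot all_order all_algebra all_fingroup.
From mathcomp Require Import boolp classical_sets functions reals.
From mathcomp Require Import complex mpoly.

Set Implicit Arguments.
Unset Strict Implicit.
Unset Printing Implicit Defensive.

Import Order.TTheory GRing.Theory Num.Theory.
Local Open Scope classical_set_scope.
Local Open Scope ring_scope.

(** * Normality and generation for a subring of a commutative ring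

    A subring is given by its underlying set [S]. *)

Section CommutativeAlgebra.
Variable A : comPzRingType.

Definition is_domain (S : set A) : Prop :=
  (1 : A) <> 0 /\
  forall a b, S a -> S b -> a * b = 0 -> a = 0 \/ b = 0.

(** The monic equation (a/b)^k = \sum_(i < k) c_i (a/b)^i over [S], with
    denominators cleared. *)
Definition integral_fraction (S : set A) (a b : A) : Prop :=
  exists (k : nat) (c : 'I_k -> A), (forall i, S (c i)) /\
    a ^+ k = \sum_(i < k) c i * a ^+ i * b ^+ (k - i).

Definition normal_domain (S : set A) : Prop :=
  is_domain S /\
  forall a b, S a -> S b -> b <> 0 -> integral_fraction S a b ->
    exists2 d, S d & a = d * b.

Definition closed_subring (D : set A) : Prop :=
  [/\ D 1, forall a b, D a -> D b -> D (a - b)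
    & forall a b, D a -> D b -> D (a * b)].

(** [S] is generated by [E] as an algebra over the subring [K]. *)
Definition generated_as_algebra (K E S : set A) : Prop :=
  forall D, closed_subring D -> K `<=` D -> E `<=` D -> S `<=` D.

End CommutativeAlgebra.

(** * Line bundles on spaces with functions *)

(** A variety in the classical language: closed points, Zariski open sets and
    regular functions.  [regular U f] only depends on the values of [f] on [U]
    in the instance below. *)
Record space_with_functions (K : fieldType) := SpaceWithFunctions {
  point : Type;
  is_open : set point -> Prop;
  regular : set point -> (point -> K) -> Prop }.

Section LineBundles.
Variables (K : fieldType) (Y : space_with_functions K).

(** A line bundle with local frames e_i on the members U_i of an open cover;
    the transition functions are given by e_i = g_ij e_j. *)
Record line_bundle := LineBundle {
  chart : Type;
  dom : chart -> set (point Y);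
  trans : chart -> chart -> point Y -> K;
  dom_open : forall i, is_open (dom i);
  dom_cover : forall y, exists i, dom i y;
  trans_regular : forall i j, regular (dom i `&` dom j) (trans i j);
  trans_id : forall i y, dom i y -> trans i i y = 1;
  trans_cocycle : forall i j k y, dom i y -> dom j y -> dom k y ->
    trans i j y * trans j k y = trans i k y }.

Variable M : line_bundle.

(** The global section of M^m equal to [phi i] e_i^m on [dom i]; the values of
    [phi i] outside [dom i] are irrelevant. *)
Definition bundle_section (m : nat) (phi : chart M -> point Y -> K) : Prop :=
  (forall i, regular (dom i) (phi i)) /\
  (forall i j y, dom i y -> dom j y ->
     phi j y = trans i j y ^+ m * phi i y).

Definition chart_point : Type :=
  {p : chart M * point Y | dom p.1 p.2}.

(** The graded ring of all H^0(Y, M^m), inside the ring of functions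
    [chart_point -> {poly K}]: the family (phi_m)_m, zero for m large, is
    encoded as (i, y) |-> \sum_m phi_m i y 'X^m. *)
Definition section_ring : set (chart_point -> {poly K}) :=
  [set F : chart_point -> {poly K} |
    (exists N : nat, forall p, (size (F p) <= N)%N) /\
    forall m, exists2 phi, bundle_section m phi &
      forall p, (F p)`_m = phi (sval p).1 (sval p).2].

Definition section_ring_degree1 : set (chart_point -> {poly K}) :=
  [set F : chart_point -> {poly K} | section_ring F /\ forall p, F p = (F p)`_1 *: 'X].

Definition constants : set (chart_point -> {poly K}) :=
  [set F : chart_point -> {poly K} | exists c : K, F = fun=> c%:P].

Definition projectively_normal : Prop :=
  normal_domain section_ring /\
  generated_as_algebra constants section_ring_degree1 section_ring.

End LineBundles.

(** * The special linear group *)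

Section SpecialLinear.
Variables (C : fieldType) (n : nat).

Definition SL : set 'M[C]_n := [set g | \det g = 1].

Definition std_torus : set 'M[C]_n := [set g | SL g /\ is_diag_mx g].

Definition std_borel : set 'M[C]_n :=
  [set g | SL g /\ forall i j : 'I_n, (j < i)%N -> g i j = 0].

(** P_r: the stabilizer of the span of the first r basis vectors. *)
Definition std_max_parabolic (r : nat) : set 'M[C]_n :=
  [set g | SL g /\ forall i j : 'I_n, (j < r <= i)%N -> g i j = 0].

Definition std_parabolic : set 'M[C]_n :=
  std_max_parabolic 1 `&` std_max_parabolic n.-1.

(** omega_r as a character of P_r: the determinant of the leading r x r block
    (completed by an identity block). *)
Definition fund_weight (r : nat) (g : 'M[C]_n) : C :=
  \det (\matrix_(i < n, j < n)
          if (i < r)%N && (j < r)%N then g i j else (i == j)%:R).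

Definition std_alpha0 (g : 'M[C]_n) : C :=
  fund_weight 1 g * fund_weight n.-1 g.

(** [g] lies in N_G(T) and its class in W = S_n is [w]. *)
Definition std_represents (w : 'S_n) (g : 'M[C]_n) : Prop :=
  SL g /\ forall i j : 'I_n, (g i j != 0) = (i == w j).

Definition weyl_parabolic : set 'S_n :=
  [set v | exists2 g, std_parabolic g & std_represents v g].

Definition weyl_length (w : 'S_n) : nat :=
  #|[pred p : 'I_n * 'I_n | (p.1 < p.2)%N && (w p.2 < w p.1)%N]|.

(** W^P.  The product of permutations in the library is composition in reverse
    order, so [(v * w)%g] is the product w v in W. *)
Definition min_length_rep (w : 'S_n) : Prop :=
  forall v, weyl_parabolic v -> (weyl_length w <= weyl_length (v * w)%g)%N.

Definition in_frame (h : 'M[C]_n) (S : set 'M[C]_n) : set 'M[C]_n :=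
  [set g | S (invmx h *m g *m h)].

End SpecialLinear.

(** * Schubert varieties in G/P, sections of the line bundle L and the quotient

    By conjugacy, the pairs T <= B of a maximal torus and a Borel subgroup of
    SL_n are given by ordered bases: for a basis [h] (columns of an invertible
    matrix) T is the stabilizer in SL_n of all the basis lines, and B the
    stabilizer of the flag spanned by the basis.

    Subsets of G/P are represented by their preimages in G, and sections of
    L^m over them by functions f with f(gp) = alpha_0(p)^m f(g) for p in P.
    For this convention H^0(G/P, L) is V(alpha_0)^*. *)

Section GITQuotient.
Variables (C : fieldType) (n : nat) (h : 'M[C]_n) (w : 'S_n).

Definition torus : set 'M[C]_n := in_frame h (@std_torus C n).
Definition borel : set 'M[C]_n := in_frame h (@std_borel C n).
Definition parabolic : set 'M[C]_n := in_frame h (@std_parabolic C n).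
Definition alpha0 (p : 'M[C]_n) : C := std_alpha0 (invmx h *m p *m h).
Definition represents : set 'M[C]_n := in_frame h (std_represents w).

Definition double_coset : set 'M[C]_n :=
  [set g | exists b x p, [/\ borel b, represents x, parabolic p
                           & g = b *m x *m p]].

Definition peval (p : {mpoly C[n * n]}) (g : 'M[C]_n) : C :=
  p.@[fun k => mxvec g ord0 k].

Definition zariski_closure (S : set 'M[C]_n) : set 'M[C]_n :=
  [set g | SL g /\
     forall p, (forall x, S x -> peval p x = 0) -> peval p g = 0].

(** The preimage of X_P(w) in G. *)
Definition schubert : set 'M[C]_n := zariski_closure double_coset.

Definition regular_on (V : set 'M[C]_n) (f : 'M[C]_n -> C) : Prop :=
  forall x, V x -> exists p q, peval q x <> 0 /\
    forall y, V y -> peval q y <> 0 -> f y = peval p y / peval q y.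

(** Sections of L^m over V/P. *)
Definition L_section (V : set 'M[C]_n) (m : nat) (f : 'M[C]_n -> C) : Prop :=
  regular_on V f /\
  forall x p, V x -> parabolic p -> f (x *m p) = alpha0 p ^+ m * f x.

Definition T_invariant (V : set 'M[C]_n) (f : 'M[C]_n -> C) : Prop :=
  forall t x, torus t -> V x -> f (t *m x) = f x.

(** H^0(X_P(w), L^m)^T *)
Definition invariant_section (m : nat) : set ('M[C]_n -> C) :=
  [set f | L_section schubert m f /\ T_invariant schubert f].

Definition semistable : set 'M[C]_n :=
  [set x | schubert x /\
     exists2 m, (0 < m)%N & exists2 s, invariant_section m s & s x <> 0].

(** The closed points of Proj of the ring of invariant sections, as homogeneous
    ideals: the image of [x] is the ideal of the sections vanishing at [x]. *)
Definition vanishing_ideal (x : 'M[C]_n) : nat -> set ('M[C]_n -> C) :=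
  fun m => [set s | invariant_section m s /\ s x = 0].

Definition git_point : Type :=
  {y : nat -> set ('M[C]_n -> C) |
     exists2 x, semistable x & y = vanishing_ideal x}.

Definition lies_over (x : 'M[C]_n) (y : git_point) : Prop :=
  semistable x /\ sval y = vanishing_ideal x.

Definition nonzero_at (m : nat) (s : 'M[C]_n -> C) (y : git_point) : Prop :=
  invariant_section m s /\ ~ sval y m s.

Definition git_open (U : set git_point) : Prop :=
  forall y, U y -> exists m s, [/\ (0 < m)%N, nonzero_at m s y
    & forall y', nonzero_at m s y' -> U y'].

(** Locally a quotient of two invariant sections of the same degree. *)
Definition git_regular (U : set git_point) (phi : git_point -> C) : Prop :=
  forall y, U y -> exists m a b, [/\ invariant_section m a, nonzero_at m b y
    & forall y' x, U y' -> nonzero_at m b y' -> lies_over x y' ->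
        phi y' = a x / b x].

Definition git_quotient : space_with_functions C :=
  SpaceWithFunctions git_open git_regular.

Definition git_preimage (U : set git_point) : set 'M[C]_n :=
  [set x | exists2 y, U y & lies_over x y].

(** [M] pulls back to the restriction of L to the semistable locus,
    T-equivariantly: [s i] is the image of the pullback of the local frame
    e_i under an isomorphism from the pullback of [M] to L. *)
Definition is_descent (M : line_bundle git_quotient) : Prop :=
  exists s : chart M -> 'M[C]_n -> C,
    (forall i : chart M, let V := git_preimage (dom i) in
       [/\ L_section V 1 (s i), T_invariant V (s i)
         & forall x, V x -> s i x <> 0]) /\
    (forall (i j : chart M) x y, dom i y -> dom j y -> lies_over x y ->
       s i x = trans i j y * s j x).

End GITQuotient.

(* Main.v *)
(** In the basis [h], write [x] for the first column of a representative of a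
    point of G/P and [y] for the last row of its inverse: G/P consists of the
    pairs ([x], [y]) with [\sum_i x_i y_i = 0], and L is O(1, 1).  Put
    a = w(1) and b = w(n); there are semistable points only if a > b, and then
    the Schubert variety is cut out by [x_i = 0] for i > a and [y_i = 0] for
    i < b.  The T-invariants of degree m are the forms of degree m
    in the products [z_i = x_i y_i], b <= i <= a, whose only relation is
    [\sum_i z_i = 0].  So the quotient is the projective space of dimension
    a - b - 1, M is O(1), and the section ring is a polynomial ring in a - b
    variables.

    Regular functions are compared along explicit curves in SL_n, which shows
    that they only depend on z; on the affine charts [z_l = 1] they pull back,
    through polynomial slices, to locally rational functions of z; and a
    homogeneous locally rational function on a punctured affine space is
    polynomial, by interpolation on lines. *)
Require Import Defs.
From HB Require Import structures.
From mathcomp Require Import all_boot all_order all_algebra all_fingroup.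
From mathcomp Require Import boolp classical_sets functions reals.
From mathcomp Require Import complex mpoly qpoly ring zify.

Set Implicit Arguments.
Unset Strict Implicit.
Unset Printing Implicit Defensive.

Import Order.TTheory GRing.Theory Num.Theory.
Local Open Scope classical_set_scope.
Local Open Scope ring_scope.

(** * Algebras of functions *)

(** Neither the coordinate ring of the Schubert variety nor its ring of T-invariants is computed. A
    section is a mere function, locally rational in the matrix entries, and what is shown is that it
    is locally a quotient of forms in z. The obstacle is that two points with the same z need not
    lie in one T-orbit: where [x_i y_i = 0], either factor may or may not vanish. Such orbits are
    joined by a limit along a curve, continuity being replaced by the finiteness of the roots of a
    nonzero polynomial. The points z = 0 are unstable and give no information, so the final
    polynomial is recovered from a punctured space; the degree bound required by interpolation comes
    from homogeneity, by looking at a line near infinity. The descent M has arbitrary charts: a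
    section of M^m becomes one function of z after multiplication by the m-th power of the local
    frame, and dividing z by the frame gives coordinates on chart points. *)

Section FunctionAlgebra.
Variables (C : comNzRingType) (X : Type).

(** Serves for polynomial functions of a parameter, of z and of a matrix alike; determinants,
    adjugates, curves and slices are then polynomial without any polynomial being written down. *)
Record function_algebra (D : set (X -> C)) : Prop := FunctionAlgebra {
  alg_cst : forall c, D (fun=> c);
  alg_add : forall f g, D f -> D g -> D (fun x => f x + g x);
  alg_mul : forall f g, D f -> D g -> D (fun x => f x * g x) }.

Definition mx_alg (D : set (X -> C)) p q (M : X -> 'M[C]_(p, q)) : Prop :=
  forall i j, D (fun x => M x i j).

Variable D : set (X -> C).
Hypothesis algD : function_algebra D.

Lemma alg_opp f : D f -> D (fun x => - f x).
Proof.
move=> Df; have := alg_mul algD (alg_cst algD (-1)) Df.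
by congr D; apply: funext => x; rewrite mulN1r.
Qed.

Lemma alg_sub f g : D f -> D g -> D (fun x => f x - g x).
Proof. by move=> Df Dg; apply: (alg_add algD Df); apply: alg_opp. Qed.

Lemma alg_exp f k : D f -> D (fun x => f x ^+ k).
Proof.
move=> Df; elim: k => [|k IHk].
  by rewrite (_ : (fun _ => _) = fun=> 1) //; apply: alg_cst.
rewrite (_ : (fun _ => _) = fun x => f x * f x ^+ k); first exact: alg_mul.
by apply: funext => x; rewrite exprS.
Qed.

Lemma alg_sum I (r : seq I) (P : pred I) (F : I -> X -> C) :
  (forall i, P i -> D (F i)) -> D (fun x => \sum_(i <- r | P i) F i x).
Proof.
move=> DF; elim: r => [|i r IHr].
  rewrite (_ : (fun _ => _) = fun=> 0); first exact: alg_cst.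
  by apply: funext => x; rewrite big_nil.
case Pi: (P i).
  rewrite (_ : (fun _ => _) =
    fun x => F i x + \sum_(j <- r | P j) F j x).
    by apply: alg_add => //; apply: DF.
  by apply: funext => x; rewrite big_cons Pi.
by move: IHr; congr D; apply: funext => x; rewrite big_cons Pi.
Qed.

Lemma alg_prod I (r : seq I) (P : pred I) (F : I -> X -> C) :
  (forall i, P i -> D (F i)) -> D (fun x => \prod_(i <- r | P i) F i x).
Proof.
move=> DF; elim: r => [|i r IHr].
  rewrite (_ : (fun _ => _) = fun=> 1); first exact: alg_cst.
  by apply: funext => x; rewrite big_nil.
case Pi: (P i).
  rewrite (_ : (fun _ => _) =
    fun x => F i x * \prod_(j <- r | P j) F j x).
    by apply: alg_mul => //; apply: DF.
  by apply: funext => x; rewrite big_cons Pi.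
by move: IHr; congr D; apply: funext => x; rewrite big_cons Pi.
Qed.

Lemma alg_meval k (v : X -> 'I_k -> C) (P : {mpoly C[k]}) :
  (forall i, D (fun x => v x i)) -> D (fun x => P.@[v x]).
Proof.
move=> Dv; rewrite (_ : (fun _ => _) = fun x =>
    \sum_(m <- msupp P) P@_m * \prod_i v x i ^+ m i).
  apply: alg_sum => m _; apply: alg_mul => //; first exact: alg_cst.
  by apply: alg_prod => i _; apply: alg_exp.
by apply: funext => x; rewrite mevalE.
Qed.

Lemma mx_alg_cst p q (A : 'M[C]_(p, q)) : mx_alg D (fun=> A).
Proof. by move=> i j; apply: alg_cst. Qed.

Lemma mx_alg_add p q (M N : X -> 'M[C]_(p, q)) :
  mx_alg D M -> mx_alg D N -> mx_alg D (fun x => M x + N x).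
Proof.
move=> DM DN i j; rewrite (_ : (fun _ => _) = fun x => M x i j + N x i j).
  exact: alg_add.
by apply: funext => x; rewrite mxE.
Qed.

Lemma mx_alg_sub p q (M N : X -> 'M[C]_(p, q)) :
  mx_alg D M -> mx_alg D N -> mx_alg D (fun x => M x - N x).
Proof.
move=> DM DN i j; rewrite (_ : (fun _ => _) = fun x => M x i j - N x i j).
  exact: alg_sub.
by apply: funext => x; rewrite !mxE.
Qed.

Lemma mx_alg_scale p q (f : X -> C) (M : X -> 'M[C]_(p, q)) :
  D f -> mx_alg D M -> mx_alg D (fun x => f x *: M x).
Proof.
move=> Df DM i j; rewrite (_ : (fun _ => _) = fun x => f x * M x i j).
  exact: alg_mul.
by apply: funext => x; rewrite mxE.
Qed.

Lemma mx_alg_mul p q r (M : X -> 'M[C]_(p, q)) (N : X -> 'M[C]_(q, r)) :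
  mx_alg D M -> mx_alg D N -> mx_alg D (fun x => M x *m N x).
Proof.
move=> DM DN i j; rewrite (_ : (fun _ => _) =
    fun x => \sum_k M x i k * N x k j).
  by apply: alg_sum => k _; apply: alg_mul.
by apply: funext => x; rewrite mxE.
Qed.

Lemma alg_det p (M : X -> 'M[C]_p) : mx_alg D M -> D (fun x => \det (M x)).
Proof.
move=> DM; apply: alg_sum => s _; apply: alg_mul => //; first exact: alg_cst.
by apply: alg_prod => i _; apply: DM.
Qed.

Lemma mx_alg_adj p (M : X -> 'M[C]_p) : mx_alg D M -> mx_alg D (fun x => \adj (M x)).
Proof.
move=> DM i j; rewrite (_ : (fun _ => _) =
    fun x => (-1) ^+ (j + i) * \det (row' j (col' i (M x)))).
  apply: alg_mul => //; first exact: alg_cst.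
  apply: alg_det => k l; move: (DM (lift j k) (lift i l)); congr D.
  by apply: funext => x; rewrite !mxE.
by apply: funext => x; rewrite mxE.
Qed.

End FunctionAlgebra.

Section PolynomialFunctions.
Variable C : fieldType.

Definition upolyfun : set (C -> C) :=
  [set f : C -> C | exists p : {poly C}, forall u, f u = p.[u]].

Definition mpolyfun d : set (('I_d -> C) -> C) :=
  [set f : ('I_d -> C) -> C | exists p : {mpoly C[d]}, forall v, f v = p.@[v]].

Definition gpolyfun n : set ('M[C]_n -> C) :=
  [set f : 'M[C]_n -> C | exists p, forall g, f g = peval p g].

Lemma upolyfun_alg : function_algebra upolyfun.
Proof.
split=> [c|f g [p fp] [q gq]|f g [p fp] [q gq]].
- by exists c%:P => u; rewrite hornerC.
- by exists (p + q) => u; rewrite hornerD fp gq.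
- by exists (p * q) => u; rewrite hornerM fp gq.
Qed.

Lemma mpolyfun_alg d : function_algebra (@mpolyfun d).
Proof.
split=> [c|f g [p fp] [q gq]|f g [p fp] [q gq]].
- by exists c%:MP => u; rewrite mevalC.
- by exists (p + q) => u; rewrite mevalD fp gq.
- by exists (p * q) => u; rewrite mevalM fp gq.
Qed.

Lemma gpolyfun_alg n : function_algebra (@gpolyfun n).
Proof.
split=> [c|f g [p fp] [q gq]|f g [p fp] [q gq]].
- by exists c%:MP => u; rewrite /peval mevalC.
- by exists (p + q) => u; rewrite /peval mevalD fp gq.
- by exists (p * q) => u; rewrite /peval mevalM fp gq.
Qed.

Lemma upolyfun_id : upolyfun id.
Proof. by exists 'X => u; rewrite hornerX. Qed.

Lemma mpolyfun_proj d i : mpolyfun (fun v : 'I_d -> C => v i).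
Proof. by exists 'X_i => v; rewrite mevalXU. Qed.

Lemma gpolyfun_id n : mx_alg (@gpolyfun n) id.
Proof.
by move=> i j; exists 'X_(mxvec_index i j) => g; rewrite /peval mevalXU mxvecE.
Qed.

Lemma alg_peval X (D : set (X -> C)) n (M : X -> 'M[C]_n) p :
  function_algebra D -> mx_alg D M -> D (fun x => peval p (M x)).
Proof.
move=> algD DM; apply: alg_meval => // k.
case/mxvec_indexP: k => i j; move: (DM i j); by congr D; apply: funext => x; rewrite mxvecE.
Qed.

End PolynomialFunctions.

(** * Univariate and multivariate polynomial functions *)

Section Univariate.
Variable C : numClosedFieldType.
Implicit Types (p q : {poly C}) (f : C -> C).

Lemma poly_fun_eq0 p : (forall u, p.[u] = 0) -> p = 0.
Proof.
move=> p0; apply/eqP/negP => /negP pn0.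
have := max_poly_roots pn0 (rs := [seq i%:R | i <- iota 0 (size p)]).
rewrite size_map size_iota ltnn => H; apply/notF/H.
  by apply/allP => x _; rewrite rootE p0.
rewrite map_inj_uniq ?iota_uniq // => i j /eqP.
by rewrite eqr_nat => /eqP.
Qed.

(** The substitute for continuity: an identity along a curve, known off finitely many parameters,
    holds at all of them. *)
Lemma poly_fun_eq0_generic p q :
  q != 0 -> (forall u, q.[u] != 0 -> p.[u] = 0) -> p = 0.
Proof.
move=> q0 H; suff /eqP : p * q = 0.
  by rewrite mulf_eq0 (negPf q0) orbF => /eqP.
apply: poly_fun_eq0 => u; rewrite hornerM.
by have [->|/H->] := eqVneq q.[u] 0; rewrite ?mulr0 ?mul0r.
Qed.

(** Over an algebraically closed field the reduced denominator has no root. *)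
Lemma locally_rational_upolyfun f :
  (forall u0, exists p q, q.[u0] != 0 /\
     forall u, q.[u] != 0 -> f u = p.[u] / q.[u]) -> upolyfun f.
Proof.
move=> fE; have [p [q [q0 fpq]]] := fE 0.
have qn0 : q != 0 by apply: contraNneq q0 => ->; rewrite horner0.
set g := gcdp p q; set p' := p %/ g; set q' := q %/ g.
have pE : p = p' * g by rewrite divpK ?dvdp_gcdl.
have qE : q = q' * g by rewrite divpK ?dvdp_gcdr.
have cop : coprimep q' p' by rewrite coprimep_sym coprimep_div_gcd ?qn0 ?orbT.
have gn0 : g != 0 by rewrite gcdp_eq0 negb_and qn0 orbT.
have key u0 : q'.[u0] != 0 /\ f u0 = p'.[u0] / q'.[u0].
  have [p1 [q1 [q10 f1]]] := fE u0.
  have q1n0 : q1 != 0 by apply: contraNneq q10 => ->; rewrite horner0.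
  have E : p' * q1 = p1 * q'.
    apply/eqP; rewrite -subr_eq0; apply/eqP.
    apply: (@poly_fun_eq0_generic _ (q * q1)); first by rewrite mulf_neq0.
    move=> u; rewrite hornerM mulf_eq0 negb_or => /andP[qu q1u].
    have := fpq _ qu; rewrite (f1 _ q1u) pE qE !hornerM => H.
    move: qu; rewrite qE hornerM mulf_eq0 negb_or => /andP[q'u gu].
    apply/eqP; rewrite hornerD hornerN !hornerM subr_eq0 -eqr_div //.
    by rewrite H -mulf_div divff // mulr1.
  (* The denominator in lowest terms divides every local denominator, so it is nonzero wherever one
     of them is. *)
  have dv : q' %| q1 by rewrite -(Gauss_dvdpr _ cop) E dvdp_mull.
  have q'u0 : q'.[u0] != 0.
    apply: contraNneq q10 => q'u; case/dvdpP: dv => k ->.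
    by rewrite hornerM q'u mulr0.
  split=> //; rewrite (f1 _ q10); apply/eqP; rewrite eqr_div //.
  by rewrite -!hornerM E.
have /size_poly1P[c c0 q'c] : size q' == 1.
  apply/negPn/negP => /closed_rootP[u /rootP q'u].
  by have [] := key u; rewrite q'u eqxx.
exists (c^-1 *: p') => u; rewrite (key u).2 q'c hornerC hornerZ mulrC //.
Qed.

End Univariate.

Lemma mcoeff_muni (R : nzRingType) n (P : {mpoly R[n.+1]}) m :
  P@_m = ((muni P)`_(m ord_max))@_[multinom m (widen_ord (leqnSn n) i) | i < n].
Proof.
rewrite muniE coef_sum raddf_sum /= {1}(mpolyE P) raddf_sum /=.
apply: eq_bigr => m' _; rewrite coefZ coefXn !mcoeffZ mcoeffX.
rewrite -scalerAl mcoeffZ; congr (_ * _).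
have -> : (m' == m) = (m ord_max == m' ord_max) &&
   ([multinom m' (widen_ord (leqnSn n) i) | i < n] ==
    [multinom m (widen_ord (leqnSn n) i) | i < n]).
  apply/eqP/andP => [->|[/eqP mm /eqP E]]; first by rewrite !eqxx.
  apply/mnmP => i; have [j ->|->] := unliftP ord_max i; last by rewrite mm.
  have := congr1 (fun m : 'X_{1..n} => m j) E; rewrite !mnmE.
  by congr (m' _ = m _); apply: val_inj; rewrite /= /bump leqNgt ltn_ord.
case: eqP => _ /=; last by rewrite mulr0 mcoeff0.
by rewrite mulr1 mcoeffX.
Qed.

Lemma meval_muni (R : comNzRingType) n (P : {mpoly R[n.+1]}) (v : 'I_n -> R) u :
  P.@[fun i => if unlift ord_max i is Some j then v j else u] =
  (map_poly (meval v) (muni P)).[u].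
Proof.
rewrite muniE mevalE raddf_sum horner_sum /=; apply: eq_bigr => m _.
rewrite map_polyZ /= map_polyXn hornerZ hornerXn mevalZ mevalX -mulrA.
congr (_ * _); rewrite big_ord_recr /= unlift_none; congr (_ * _).
apply: eq_bigr => i _; rewrite mnmE; congr (_ ^+ _).
have -> : widen_ord (leqnSn n) i = lift ord_max i.
  by apply: val_inj; rewrite /= /bump leqNgt ltn_ord.
by rewrite liftK.
Qed.

Lemma meval_homog (R : comNzRingType) d k (P : {mpoly R[d]}) c v :
  P \is k.-homog -> P.@[fun i => c * v i] = c ^+ k * P.@[v].
Proof.
move=> /dhomogP homP; rewrite !mevalE mulr_sumr !big_seq; apply: eq_bigr => m mP.
rewrite mulrCA; congr (_ * _).
rewrite (eq_bigr (fun i => c ^+ m i * v i ^+ m i)) => [|i _]; last by rewrite exprMn.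
by rewrite big_split /= prodrXr; rewrite -mdegE; congr (c ^+ _ * _); apply: homP.
Qed.

Section Multivariate.
Variable C : numClosedFieldType.

Lemma mpoly_fun_eq0 n (P : {mpoly C[n]}) : (forall v, P.@[v] = 0) -> P = 0.
Proof.
elim: n P => [|n IHn] P P0.
  apply/mpolyP => m; rewrite mcoeff0.
  have := P0 (fun=> 0); rewrite mevalE.
  have mE (m' : 'X_{1..0}) : m' = m by apply/mnmP; case.
  rewrite (eq_bigr (fun m' => P@_m)) => [|m' _].
    have := msupp_uniq P; have [|] := boolP (m \in msupp P); last first.
      by rewrite mcoeff_msupp negbK => /eqP.
    case: (msupp P) => [//|m1 [|m2 s]] _; first by rewrite big_seq1.
    by rewrite (mE m1) (mE m2) /= !inE eqxx.
  by rewrite big_ord0 mulr1 (mE m').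
suff muni0 : muni P = 0 by apply/mpolyP => m; rewrite mcoeff_muni muni0 coef0 !mcoeff0.
apply/polyP => k; rewrite coef0; apply: IHn => v.
suff /polyP/(_ k) : map_poly (meval v) (muni P) = 0.
  by rewrite coef_map coef0.
by apply: poly_fun_eq0 => u; rewrite -meval_muni.
Qed.

Section Interpolation.
Variables (d m : nat) (Phi : ('I_d -> C) -> C).

Definition set_coord (z : 'I_d -> C) j u : 'I_d -> C :=
  fun i => if i == j then u else z i.

Hypothesis Phi_line : forall z j, exists2 r : {poly C}, (size r <= m.+1)%N &
  forall u, Phi (set_coord z j u) = r.[u].

(** Lagrange interpolation at 0, ..., m, one coordinate at a time. *)
Lemma separately_polynomial : mpolyfun Phi.
Proof.
(* The first [k] coordinates vary with [z], the others are frozen at [z0]; each round of [step]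
   frees one more. *)
pose mix k (z0 z : 'I_d -> C) : 'I_d -> C := fun i => if (i < k)%N then z i else z0 i.
pose node i : C := i%:R.
pose L i : {poly C} := tnth (lagrange m.+1 node) i.
have node_inj : injective node by move=> i j /eqP; rewrite eqr_nat => /eqP.
have lagr (r : {poly C}) u : (size r <= m.+1)%N ->
    r.[u] = \sum_(i < m.+1) r.[node i] * (L i).[u].
  move=> sr; rewrite {1}(lagrange_gen (ltn0Sn m) node_inj sr).
  by rewrite horner_sum; apply: eq_bigr => i _; rewrite hornerM hornerC.
have step k : (k <= d)%N -> forall z0, mpolyfun (fun z => Phi (mix k z0 z)).
  elim: k => [_ z0|k IHk ltkd z0].
    by exists (Phi z0)%:MP => z; rewrite mevalC.
  pose j := Ordinal ltkd.
  rewrite (_ : (fun _ => _) = fun z => \sum_(i < m.+1)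
      Phi (mix k (set_coord z0 j (node i)) z) *
      (L i).[z j]).
    apply: (alg_sum (mpolyfun_alg C d)) => i _; apply: (alg_mul (mpolyfun_alg C d)).
      exact/IHk/ltnW.
    rewrite (_ : (fun _ => _) = fun z => \sum_(l < size (L i))
        (L i)`_l * z j ^+ l).
      apply: (alg_sum (mpolyfun_alg C d)) => l _; apply: (alg_mul (mpolyfun_alg C d)).
        exact: (alg_cst (mpolyfun_alg C d)).
      exact/(alg_exp (mpolyfun_alg C d))/mpolyfun_proj.
    by apply: funext => z; rewrite horner_coef.
  apply: funext => z; have [r sr rE] := Phi_line (mix k z0 z) j.
  have -> : mix k.+1 z0 z = set_coord (mix k z0 z) j (z j).
    apply: funext => i; rewrite /mix /set_coord ltnS leq_eqVlt -val_eqE /=.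
    by case: eqP => //= ik; congr z; apply: val_inj.
  rewrite rE (lagr _ _ sr); apply: eq_bigr => i _; rewrite -rE; congr (Phi _ * _).
  apply: funext => l; rewrite /mix /set_coord -val_eqE /=.
  by case: eqP => [->|//]; rewrite ltnn.
have [P PE] := step d (leqnn d) (fun=> 0); exists P => z; rewrite -PE.
by congr Phi; apply: funext => i; rewrite /mix ltn_ord.
Qed.

End Interpolation.

(** * Homogeneous locally rational functions off the origin *)

Section HomogeneousLocallyRational.
Variables (d m : nat) (Phi : ('I_d -> C) -> C).

Hypothesis Phi_homog : forall c z, c != 0 -> (exists i, z i != 0) ->
  Phi (fun i => c * z i) = c ^+ m * Phi z.

Hypothesis Phi_rat : forall l z, z l = 1 -> exists P Q : {mpoly C[d]},
  Q.@[z] != 0 /\ forall z', z' l = 1 -> Q.@[z'] != 0 -> Phi z' = P.@[z'] / Q.@[z'].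

(** As [v l = 0], coordinate [l] is constant and nonzero on the line; dividing by it moves the line
    into the affine chart, where [Phi] is rational near every parameter. *)
Let Phi_line_poly l z (v : 'I_d -> C) : z l != 0 -> v l = 0 ->
  upolyfun (fun u => Phi (fun i => z i + u * v i)).
Proof.
move=> zl vl; apply: locally_rational_upolyfun => u0.
pose w u i := (z l)^-1 * (z i + u * v i).
have wl u : w u l = 1 by rewrite /w vl mulr0 addr0 mulVf.
have [P [Q [Q0 PQ]]] := Phi_rat (wl u0).
have wpoly (R : {mpoly C[d]}) : upolyfun (fun u => R.@[w u]).
  apply: (alg_meval (upolyfun_alg C)) => i.
  apply: (alg_mul (upolyfun_alg C)); first exact: (alg_cst (upolyfun_alg C)).
  apply: (alg_add (upolyfun_alg C)); first exact: (alg_cst (upolyfun_alg C)).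
  apply: (alg_mul (upolyfun_alg C)); first exact: upolyfun_id.
  exact: (alg_cst (upolyfun_alg C)).
have [[p pE] [q qE]] := (wpoly P, wpoly Q).
exists (z l ^+ m *: p), q; rewrite -qE; split=> // u; rewrite -qE => Qu.
rewrite hornerZ -pE -mulrA -(PQ _ (wl u) Qu) -Phi_homog //.
  by congr Phi; apply: funext => i; rewrite /w mulVKf.
by exists l; rewrite wl oner_eq0.
Qed.

Let unit_vec (j i : 'I_d) : C := (i == j)%:R.

(** The degree bound: for u nonzero, Phi(z + u e_j) = u^m Phi(e_j + u^-1 z), and the last factor is
    a polynomial in u^-1, so [r] grows at most like u^m. *)
Let Phi_axis_line z (j l : 'I_d) : z j = 0 -> z l != 0 ->
  exists2 r : {poly C}, (size r <= m.+1)%N &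
    forall u, Phi (set_coord z j u) = r.[u].
Proof.
move=> zj zl.
have ulj : unit_vec j l = 0.
  by rewrite /unit_vec; case: (eqVneq l j) zl => [->|_ _] //; rewrite zj eqxx.
have ujj : unit_vec j j != 0 by rewrite /unit_vec eqxx oner_eq0.
have [r rE] := Phi_line_poly zl ulj.
have [R RE] := Phi_line_poly ujj zj.
exists r => [|u]; last first.
  rewrite -rE; congr Phi; apply: funext => i; rewrite /set_coord /unit_vec.
  by case: eqP => [->|_]; rewrite ?zj ?mulr1 ?mulr0 ?addr0 ?add0r.
have [->|rn0] := eqVneq r 0; first by rewrite size_poly0.
(* [S] is [R] with reversed coefficients, S(u) = u^N R(1/u); the identity becomes X^N r = X^m S with
   S of degree at most N. *)
pose N := size R; pose S := \poly_(i < N.+1) R`_(N - i).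
have SE u : u != 0 -> S.[u] = u ^+ N * R.[u^-1].
  move=> u0; rewrite horner_poly (horner_coef_wide _ (leqnSn N)).
  rewrite mulr_sumr (reindex_inj rev_ord_inj) /=; apply: eq_bigr => i _.
  have le_iN : (i <= N)%N by rewrite -ltnS.
  rewrite subSS subKn // mulrCA; congr (_ * _).
  have -> : u ^+ N = u ^+ (N - i) * u ^+ i by rewrite -exprD subnK.
  by rewrite -mulrA exprVn mulfV ?expf_neq0 // mulr1.
have /eqP : 'X^N * r - 'X^m * S = 0.
  apply: (@poly_fun_eq0_generic _ _ 'X); first by rewrite polyX_eq0.
  move=> u; rewrite hornerX => u0; rewrite hornerD hornerN !hornerM !hornerXn.
  rewrite SE // -rE -RE mulrCA; apply/eqP; rewrite subr_eq0; apply/eqP.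
  congr (_ * _); rewrite -Phi_homog //; last by exists j; rewrite zj mulr0 addr0.
  by congr Phi; apply: funext => i; rewrite mulrDr mulVKf // addrC.
rewrite subr_eq0 => /eqP E.
have := congr1 (fun p : {poly C} => size p) E.
rewrite /= size_monicM ?monicXn // size_polyXn addSn /= => Er.
have := size_polyMleq 'X^m S; rewrite -Er size_polyXn addSn /= => le1.
have := leq_trans le1 (leq_add (leqnn m) (size_poly _ _)).
by rewrite addnS -addSn addnC leq_add2r.
Qed.

Lemma homogeneous_locally_rational : exists2 P : {mpoly C[d]}, P \is m.-homog &
  forall z, (exists i, z i != 0) -> Phi z = P.@[z].
Proof.
case: (posnP d) => [d0|d_gt0].
  exists 0; first exact: dhomog0.
  by move=> z [i _]; exfalso; have := ltn_ord i; rewrite [X in (_ < X)%N]d0.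
pose i0 := Ordinal d_gt0.
(* The value at the origin must make [Psi] polynomial on the coordinate axes, where it is u^m
   Phi(e_j): this forces 0 for m > 0 and, for m = 0, a value that must not depend on j. *)
pose Psi z := if [exists i, z i != 0] then Phi z
              else if m == 0%N then Phi (unit_vec i0) else 0.
have PsiE z i : z i != 0 -> Psi z = Phi z.
  by move=> zi; rewrite /Psi; case: existsP => // -[]; exists i.
have const_unit j : m = 0%N -> Phi (unit_vec j) = Phi (unit_vec i0).
  move=> m0; have [->//|ji0] := eqVneq j i0.
  (* In degree 0 the bound makes [Phi] constant on axis lines, so it agrees at e_k and e_k + e_l. *)
  have aux (k l : 'I_d) : k != l ->
      Phi (unit_vec k) = Phi (fun i => unit_vec k i + unit_vec l i).
    move=> kl.
    have z1 : unit_vec k l = 0 by rewrite /unit_vec eq_sym (negPf kl).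
    have z2 : unit_vec k k != 0 by rewrite /unit_vec eqxx oner_eq0.
    have [r] := Phi_axis_line z1 z2.
    rewrite m0 => /size1_polyC -> rE.
    have := rE 1; have := rE 0; rewrite !hornerC => <-.
    have -> : set_coord (unit_vec k) l 0 = unit_vec k.
      by apply: funext => i; rewrite /set_coord; case: eqP => // ->; rewrite z1.
    move=> <-; congr Phi; apply: funext => i; rewrite /set_coord.
    rewrite /(unit_vec l i).
    by case: eqP => [->|_]; rewrite ?z1 ?addr0 ?add0r.
  rewrite (aux _ _ ji0) [RHS](aux i0 j) 1?eq_sym //.
  by congr Phi; apply: funext => i; rewrite addrC.
have [P PE] : mpolyfun Psi.
  apply: (@separately_polynomial _ m) => z j.
  have [/existsP[l]|noti] := boolP [exists l, set_coord z j 0 l != 0].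
    move=> zl.
    have zj : set_coord z j 0 j = 0 by rewrite /set_coord eqxx.
    have lj : l != j by apply: contraNneq zl => ->; rewrite zj.
    have [r sr rE] := Phi_axis_line zj zl; exists r => // u; rewrite -rE.
    rewrite (@PsiE _ l); last by move: zl; rewrite /set_coord (negPf lj).
    by congr Phi; apply: funext => i; rewrite /set_coord; case: ifP.
  have z0 i : i != j -> z i = 0.
    move=> ij; move: noti; rewrite negb_exists => /forallP/(_ i).
    by rewrite /set_coord (negPf ij) negbK => /eqP.
  exists (Phi (unit_vec j) *: 'X^m) => [|u].
    by apply: (leq_trans (size_scale_leq _ _)); rewrite size_polyXn.
  rewrite hornerZ hornerXn; have [->|u0] := eqVneq u 0.
    rewrite /Psi ifN; last first.
      apply/existsPn => i; rewrite negbK /set_coord.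
      by case: (eqVneq i j) => [|/z0->].
    case: (posnP m) => [m0|m_gt0]; first by rewrite m0 expr0 mulr1 const_unit.
    by rewrite expr0n gtn_eqF // mulr0.
  rewrite (@PsiE _ j); last by rewrite /set_coord eqxx.
  rewrite mulrC -Phi_homog //; last by exists j; rewrite /unit_vec eqxx oner_eq0.
  congr Phi; apply: funext => i; rewrite /set_coord /unit_vec.
  by case: (eqVneq i j) => [|/z0->]; rewrite ?mulr1 ?mulr0.
exists (pihomog mdeg m P); first exact: pihomogP.
move=> z [i zi]; pose K := (maxn (msize P) m.+1).
have PK : P = \sum_(k < K) pihomog mdeg k P.
  by apply: (@pihomog_partitionE _ _ mdeg); rewrite leq_max leqnn.
(* P(cz) = c^m Phi(z) for all nonzero c, and the coefficient of c^m isolates the component of degree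
   m. *)
pose r := \poly_(k < K) (pihomog mdeg k P).@[z].
have : r - Phi z *: 'X^m = 0.
  apply: (@poly_fun_eq0_generic _ _ 'X); first by rewrite polyX_eq0.
  move=> c; rewrite hornerX => c0; rewrite hornerD hornerN hornerZ hornerXn.
  apply/eqP; rewrite subr_eq0 mulrC -Phi_homog //; last by exists i.
  rewrite -(@PsiE _ i) ?mulf_neq0 // PE horner_poly [X in X.@[_]]PK raddf_sum /=.
  by apply/eqP/eq_bigr => k _; rewrite (meval_homog _ _ (pihomogP _ _ _)) mulrC.
move/polyP/(_ m); rewrite coefB coefZ coefXn eqxx mulr1 coef0 coef_poly.
by rewrite leq_max leqnn orbT => /eqP; rewrite subr_eq0 => /eqP ->.
Qed.

End HomogeneousLocallyRational.

End Multivariate.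

(** * Normality of polynomial rings *)

Section Normality.
Variables (C : fieldType) (d : nat).
Implicit Types a b c : {mpoly C[d]}.

(** Comparing leading monomials for large [N] shows that that of [b] divides
    that of [a], which starts a division of [a] by [b]. *)
Lemma mpoly_almost_integral_dvd a b c : b != 0 -> c != 0 ->
  (forall N, exists e, c * a ^+ N = e * b ^+ N) -> exists q, a = q * b.
Proof.
move=> b0 c0; move: {2}(mlead a) (erefl (mlead a)) => m.
elim/(@ltmwf d): m a => m IH a am aN; have [->|a0] := eqVneq a 0.
  by exists 0; rewrite mul0r.
(* Writing x, y, z, t for the i-th exponents of c, a, b, e and taking N = x + 1, one has x + N y = t
   + N z; if y < z this would give N <= x. *)
have le_ba : (mlead b <= mlead a)%MM.
  apply/mnm_lepP => i; have [e eN] := aN (mlead c i).+1.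
  have e0 : e != 0.
    apply: contra_neq (mulf_neq0 c0 (expf_neq0 (mlead c i).+1 a0)) => e0.
    by rewrite eN e0 mul0r.
  have := congr1 (fun p => mlead p i) eN.
  rewrite /= !mleadM ?expf_neq0 // !mleadX // !mnmDE !mulmnE => H.
  rewrite leqNgt; apply/negP; move: H.
  move: (mlead c i) (mlead a i) (mlead b i) (mlead e i) => x y z t H lt_yz.
  by nia.
pose q0 := (mleadc a / mleadc b) *: 'X_[mlead a - mlead b].
have q0b0 : mleadc a / mleadc b != 0.
  by rewrite mulf_neq0 ?invr_eq0 ?mleadc_eq0.
have q00 : q0 != 0.
  rewrite /q0 -mleadc_eq0 mleadcZE mulf_neq0 // mleadXm mcoeffX eqxx.
  exact: oner_neq0.
have lq0b : mlead (q0 * b) = mlead a by rewrite mleadM // mleadZ // mleadXm submK.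
have cq0b : (q0 * b)@_(mlead a) = mleadc a.
  rewrite -lq0b mleadM // mleadcM mleadZ // mcoeffZ mleadXm mcoeffX eqxx mulr1.
  by rewrite submK // divfK // mleadc_eq0.
pose a' := a - q0 * b.
suff [q a'E] : exists q, a' = q * b.
  by exists (q + q0); rewrite mulrDl -a'E subrK.
have [->|a'0] := eqVneq a' 0; first by exists 0; rewrite mul0r.
apply: (IH (mlead a')) => // [|N].
  rewrite -am lt_neqAle; apply/andP; split.
    apply: contraNneq a'0 => E; rewrite -mleadc_eq0 E mcoeffB cq0b subrr //.
  by apply: (le_trans (mleadB_le _ _)); rewrite lq0b joinxx.
have [e eE] := choice aN.
(* The hypothesis passes to [a']: each binomial term c a^(N-i) (q0 b)^i of c (a - q0 b)^N is a
   multiple of b^N. *)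
exists (\sum_(i < N.+1) ((-1) ^+ i * e (N - i)%N * q0 ^+ i) *+ 'C(N, i)).
rewrite exprBn mulr_sumr mulr_suml; apply: eq_bigr => i _.
rewrite mulrnAr mulrnAl; congr (_ *+ _).
have le_iN : (i <= N)%N by rewrite -ltnS.
have -> : b ^+ N = b ^+ (N - i) * b ^+ i by rewrite -exprD subnK.
transitivity ((-1) ^+ i * (c * a ^+ (N - i)) * (q0 * b) ^+ i).
  by move: ((-1) ^+ i) ((q0 * b) ^+ i) (a ^+ _) => *; ring.
by rewrite eE exprMn; move: ((-1) ^+ i) (q0 ^+ i) (b ^+ i) (b ^+ _) => *; ring.
Qed.

Lemma mpoly_integral_dvd a b : b != 0 ->
  integral_fraction setT a b -> exists2 q, setT q & a = q * b.
Proof.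
move=> b0 [k [c [_ ak]]].
suff [q ->] : exists q, a = q * b by exists q.
(* b^k is a common denominator for all powers of a/b, because the monic equation reduces them to
   powers below k. *)
apply: (@mpoly_almost_integral_dvd _ _ (b ^+ k)); rewrite ?expf_neq0 // => N.
elim/ltn_ind: N => N IHN; have [le_Nk|lt_kN] := leqP N k.
  exists (a ^+ N * b ^+ (k - N)); rewrite -mulrA -exprD subnK // mulrC //.
have {}IHN (i : 'I_k) : exists e, b ^+ k * a ^+ (N - k + i) = e * b ^+ (N - k + i).
  by apply: IHN; have := ltn_ord i; lia.
have [e eE] := choice IHN.
exists (\sum_(i < k) c i * e i).
rewrite -{1}(subnK (ltnW lt_kN)) exprD mulrCA ak mulr_suml.
rewrite mulr_sumr mulr_sumr; apply: eq_bigr => i _.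
transitivity (c i * b ^+ (k - i) * (b ^+ k * a ^+ (N - k + i))).
  by rewrite exprD; move: (b ^+ _) (a ^+ i) (a ^+ _) (b ^+ k) => *; ring.
rewrite eE; transitivity (c i * e i * (b ^+ (k - i) * b ^+ (N - k + i))).
  by move: (b ^+ _) (b ^+ (_ + _)) => *; ring.
by rewrite -exprD; congr (_ * _ ^+ _); have := ltn_ord i; lia.
Qed.

End Normality.

(** * Evaluation that keeps track of degrees *)

Section GradedEvaluation.
Variables (C : comNzRingType) (d : nat).

(** [\sum_m P_m(v) 'X^m], where [P_m] is the component of degree [m] of [P]. *)
Definition graded_eval (v : 'I_d -> C) (P : {mpoly C[d]}) : {poly C} :=
  mmap (@polyC C) (fun i => v i *: 'X) P.

HB.instance Definition _ v := GRing.RMorphism.copy (graded_eval v)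
  (mmap (@polyC C) (fun i => v i *: 'X)).

Lemma coef_graded_eval v P m : (graded_eval v P)`_m = (pihomog mdeg m P).@[v].
Proof.
rewrite /graded_eval /mmap coef_sum pihomogE raddf_sum /= [RHS]big_mkcond /=.
apply: eq_bigr => m' _; rewrite /mmap1.
rewrite (eq_bigr (fun i => (v i ^+ m' i) *: 'X^(m' i))) => [|i _]; last first.
  by rewrite exprZn.
rewrite scaler_prod prodrXr -mdegE coefCM coefZ coefXn eq_sym.
case: eqP => _; last by rewrite !mulr0.
by rewrite mulr1 mevalZ mevalX.
Qed.

End GradedEvaluation.

(** * Flags and shears *)

(** One block matrix factors as lower times upper and as upper times lower; the determinants
    agree. *)
Lemma det_rank_one_update (R : comNzRingType) n (u : 'cV[R]_n) (v : 'rV[R]_n) :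
  \det (1%:M + u *m v) = 1 + (v *m u) ord0 ord0.
Proof.
have E1 : block_mx 1%:M v (- u) 1%:M =
    block_mx 1%:M 0 (- u) 1%:M *m block_mx 1%:M v 0 (1%:M + u *m v).
  rewrite mulmx_block !mul1mx !mul0mx !mulmx1 !addr0 mulNmx.
  by rewrite addrCA addNr addr0.
have E2 : block_mx 1%:M v (- u) 1%:M =
    block_mx 1%:M v 0 1%:M *m block_mx (1%:M + v *m u) 0 (- u) 1%:M.
  rewrite mulmx_block !mul1mx !mul0mx !mulmx1 !add0r mulmxN.
  by rewrite addrK.
have := congr1 (fun M => \det M) E1; rewrite /= E2 !det_mulmx.
rewrite !det_ublock !det_lblock !det1 !mul1r !mulr1 => <-.
by rewrite det_mx11 !mxE eqxx mulr1n.
Qed.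

Lemma det_upper_trig (R : comNzRingType) n (k : 'M[R]_n) :
  (forall i j : 'I_n, (j < i)%N -> k i j = 0) -> \det k = \prod_i k i i.
Proof.
move=> up; rewrite -det_tr det_trig; first by apply: eq_bigr => i _; rewrite mxE.
by apply/is_trig_mxP => i j ij; rewrite mxE up.
Qed.

(** Locked, because [mxE] would otherwise unfold these matrices. *)
HB.lock Definition frame (C : fieldType) (n : nat) (h g : 'M[C]_n) : 'M[C]_n :=
  invmx h *m g *m h.

(** The line and the hyperplane of the flag [g P]: coordinates, in the basis
    [h], of a spanning vector and of a linear form. *)
HB.lock Definition xv (C : fieldType) (n : nat) (h g : 'M[C]_n.+1) : 'cV[C]_n.+1 :=
  col ord0 (frame h g).
HB.lock Definition yv (C : fieldType) (n : nat) (h g : 'M[C]_n.+1) : 'rV[C]_n.+1 :=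
  row ord_max (\adj (frame h g)).

Section Frame.
Variables (C : fieldType) (n0 : nat).
Local Notation n := n0.+2.
Variables (h : 'M[C]_n) (h_unit : h \in unitmx).
Implicit Types (g k p : 'M[C]_n).

Local Notation frame := (frame h).
Local Notation xv := (xv h).
Local Notation yv := (yv h).

Definition unframe k : 'M[C]_n := h *m k *m invmx h.

Lemma unframeK k : frame (unframe k) = k.
Proof. by rewrite frame.unlock /unframe !mulmxA mulVmx // mul1mx mulmxKV. Qed.

Lemma frameK g : unframe (frame g) = g.
Proof. by rewrite frame.unlock /unframe !mulmxA mulmxV // mul1mx mulmxK. Qed.

Lemma frameM g k : frame (g *m k) = frame g *m frame k.
Proof. by rewrite frame.unlock !mulmxA mulmxK. Qed.

Lemma unframeM g k : unframe (g *m k) = unframe g *m unframe k.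
Proof. by rewrite /unframe !mulmxA mulmxKV. Qed.

Lemma frameE g : frame g = invmx h *m g *m h. Proof. by rewrite frame.unlock. Qed.

Lemma det_frame g : \det (frame g) = \det g.
Proof. by rewrite frame.unlock !det_mulmx mulrAC -det_mulmx mulVmx // det1 mul1r. Qed.

Lemma det_unframe k : \det (unframe k) = \det k.
Proof. by rewrite -[in RHS](unframeK k) det_frame. Qed.

Lemma SL_unit g : SL g -> g \in unitmx.
Proof. by rewrite /SL /= unitmxE => ->; apply: unitr1. Qed.

Lemma SL_mul g k : SL g -> SL k -> SL (g *m k).
Proof. by rewrite /SL /= det_mulmx => -> ->; rewrite mulr1. Qed.

Lemma SL_frame g : SL (frame g) <-> SL g.
Proof. by rewrite /SL /= det_frame. Qed.

Lemma xvE g i : xv g i 0 = frame g i ord0. Proof. by rewrite xv.unlock mxE. Qed.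

Lemma yvE g i : yv g 0 i = \adj (frame g) ord_max i. Proof. by rewrite yv.unlock mxE. Qed.

Lemma xvM g k : xv (g *m k) = frame g *m xv k.
Proof. by rewrite xv.unlock frameM !colE mulmxA. Qed.

Lemma yv_frame g : SL g -> yv g *m frame g = delta_mx 0 ord_max.
Proof.
move=> /SL_frame; rewrite /SL /= => dg.
by rewrite yv.unlock -row_mul mul_adj_mx dg rowE mulmx1.
Qed.

(** The adjugate makes [yv] polynomial on all matrices; on SL_n this linear equation characterizes
    it, and later values of [yv] are found by solving it. *)
Lemma yv_uniq g v : SL g -> v *m frame g = delta_mx 0 ord_max -> v = yv g.
Proof.
move=> sg vE; apply: (@row_free_inj _ _ _ _ (frame g)); last by rewrite vE yv_frame.
by rewrite row_free_unit; apply/SL_unit/SL_frame.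
Qed.

Lemma xv_frame g : xv g = frame g *m delta_mx ord0 0.
Proof. by rewrite xv.unlock colE. Qed.

Lemma yv_xv g : SL g -> yv g *m xv g = 0.
Proof.
move=> sg; rewrite xv_frame mulmxA yv_frame // mul_delta_mx_0 //.
Qed.

Lemma yv_unframe k g : SL g -> SL k -> yv (unframe k *m g) *m k = yv g.
Proof.
move=> sg sk; apply: yv_uniq => //; rewrite -mulmxA -{2}(unframeK k) -frameM.
apply: yv_frame; apply: SL_mul => //.
by rewrite /SL /= det_unframe.
Qed.

(** For v u = 0 this is multiplication by a transvection, with inverse 1 - u v. It is polynomial in
    u and v and acts simply on line and hyperplane, so it supplies the explicit curves in SL_n. *)
Definition shear (u : 'cV[C]_n) (v : 'rV[C]_n) g := unframe (1%:M + u *m v) *m g.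

Lemma shear0l v g : shear 0 v g = g.
Proof. by rewrite /shear mul0mx addr0 /unframe mulmx1 mulmxV // mul1mx. Qed.

Section Shear.
Variables (u : 'cV[C]_n) (v : 'rV[C]_n) (g : 'M[C]_n).
Hypotheses (vu : v *m u = 0) (sg : SL g).

Lemma SL_shear : SL (shear u v g).
Proof.
by apply: SL_mul => //; rewrite /SL /= det_unframe det_rank_one_update vu mxE addr0.
Qed.

Lemma xv_shear : xv (shear u v g) = xv g + u *m (v *m xv g).
Proof. by rewrite /shear xvM unframeK mulmxDl mul1mx mulmxA. Qed.

Lemma yv_shear : yv (shear u v g) = yv g - (yv g *m u) *m v.
Proof.
apply/esym/yv_uniq; first exact: SL_shear.
rewrite /shear frameM unframeK mulmxA mulmxDr mulmx1 mulmxA mulmxBl.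
by rewrite -(mulmxA _ v u) vu mulmx0 subr0 subrK yv_frame.
Qed.
End Shear.

End Frame.

Section Flags.
Variables (C : fieldType) (n0 : nat).
Local Notation n := n0.+2.
Variables (h : 'M[C]_n) (h_unit : h \in unitmx).
Implicit Types (g k p : 'M[C]_n).
Local Notation frame := (frame h).
Local Notation unframe := (unframe h).
Local Notation xv := (xv h).
Local Notation yv := (yv h).

Lemma fund_weight1 k : fund_weight 1 k = k ord0 ord0.
Proof.
rewrite /fund_weight (expand_det_row _ ord0) big_ord_recl mxE /=.
rewrite big1 ?addr0 => [|i _]; last by rewrite mxE /= mul0r.
rewrite [cofactor _ _ _](_ : _ = 1) ?mulr1 // /cofactor /= expr0 mul1r.
rewrite [X in \det X](_ : _ = 1%:M) ?det1 //; apply/matrixP => i j.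
by rewrite !mxE /= (inj_eq lift_inj).
Qed.

(** Expand both determinants along the last row. On SL_n the weight omega_(n-1) is thus the inverse
    of the last diagonal entry, the factor by which [yv] scales. *)
Lemma fund_weight_pred k : (forall j : 'I_n, j != ord_max -> k ord_max j = 0) ->
  fund_weight n.-1 k * k ord_max ord_max = \det k.
Proof.
move=> k0; rewrite /fund_weight !(expand_det_row _ ord_max).
rewrite [in RHS](bigD1 ord_max) //= [X in _ = _ + X]big1 => [|j /k0 ->]; last by rewrite mul0r.
rewrite (bigD1 ord_max) //= [X in _ + X]big1 => [|j jm]; last first.
  by rewrite mxE /= ltnn /= eq_sym (negPf jm) mul0r.
rewrite mxE /= ltnn /= eqxx !addr0 mul1r mulrC; congr (_ * _).
rewrite /cofactor; congr (_ * \det _); apply/matrixP => i j.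
have lt_lift (l : 'I_n.-1) : (lift ord_max l < n.-1)%N.
  by rewrite lift_max.
by rewrite !mxE !lt_lift.
Qed.

(** Here [c] is the first diagonal entry of [p] and [d] the inverse of the last. *)
Lemma parabolic_act g p : SL g -> parabolic h p -> exists c d,
  [/\ SL p, xv (g *m p) = c *: xv g, yv (g *m p) = d *: yv g & alpha0 h p = c * d].
Proof.
move=> sg [[sp p1] [_ pn]].
have SLp : SL p by apply/(SL_frame h_unit); rewrite frameE.
pose k := frame p.
have {}p1 (i j : 'I_n) : (j < 1 <= i)%N -> k i j = 0 by rewrite /k frameE; exact: p1.
have {}pn (i j : 'I_n) : (j < n.-1 <= i)%N -> k i j = 0 by rewrite /k frameE; exact: pn.
have k0 : k *m delta_mx ord0 0 = k ord0 ord0 *: delta_mx ord0 (0 : 'I_1).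
  apply/matrixP => i j; rewrite ord1 -colE !mxE eqxx andbT.
  have [->|i0] := eqVneq i ord0; first by rewrite mulr1.
  by rewrite mulr0; apply: p1; rewrite /= lt0n.
have km j : j != ord_max -> k ord_max j = 0.
  move=> jm; apply: pn; rewrite leqnn andbT ltn_neqAle -ltnS ltn_ord andbT.
  by apply: contra jm => /eqP E; apply/eqP/val_inj.
have kn : delta_mx (0 : 'I_1) ord_max *m k = k ord_max ord_max *: delta_mx 0 ord_max.
  apply/matrixP => i j; rewrite ord1 -rowE !mxE eqxx /=.
  by have [->|/km->] := eqVneq j ord_max; rewrite ?mulr1 ?mulr0.
have fw := fund_weight_pred km.
have dk : \det k = 1 by rewrite /k frameE.
have kmm : k ord_max ord_max != 0.
  by apply/eqP => E; move: fw; rewrite E mulr0 dk => /esym/eqP; rewrite oner_eq0.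
exists (k ord0 ord0), (k ord_max ord_max)^-1; split=> //.
- by rewrite xvM // xv_frame k0 -scalemxAr -xv_frame.
- apply/esym/yv_uniq => //; first exact: SL_mul.
  rewrite frameM // mulmxA -scalemxAl yv_frame // -scalemxAl kn scalerA.
  by rewrite mulVf // scale1r.
- rewrite /alpha0 /std_alpha0 -frameE fund_weight1; congr (_ * _).
  by apply: (mulIf kmm); rewrite mulVf // fw.
Qed.

(** The matrix g^-1 g' multiplies the first basis vector by c and the last coordinate form by d^-1,
    which is membership in P. So (x, y) determines the point of G/P, and its scaling records the
    character. *)
Lemma same_flag g g' c d : SL g -> SL g' ->
  xv g' = c *: xv g -> yv g' = d *: yv g ->
  exists p, [/\ parabolic h p, g' = g *m p & alpha0 h p = c * d].
Proof.
move=> sg sg' xE yE; pose p := invmx g *m g'.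
have ug := SL_unit sg.
have g'E : g' = g *m p by rewrite /p mulmxA mulmxV // mul1mx.
have sp : SL p.
  have := sg'; rewrite /SL /= g'E det_mulmx.
  by have -> : \det g = 1 by []; rewrite mul1r.
have ufg : frame g \in unitmx by apply/SL_unit/(SL_frame h_unit).
pose k := frame p.
have dk : \det k = 1 by apply/(SL_frame h_unit).
have k0 : k *m delta_mx ord0 0 = c *: delta_mx ord0 (0 : 'I_1).
  apply: (can_inj (mulKmx ufg)).
  by rewrite mulmxA -frameM // -g'E -xv_frame xE xv_frame -scalemxAr.
have kn : d *: (delta_mx (0 : 'I_1) ord_max *m k) = delta_mx 0 ord_max.
  rewrite -[in LHS](yv_frame h_unit sg) -mulmxA -frameM // -g'E scalemxAl -yE.
  exact: yv_frame.
have k0E i : k i ord0 = c * (i == ord0)%:R.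
  have /matrixP/(_ i 0) := k0; rewrite -colE !mxE eqxx andbT => ->.
  by [].
have knE j : d * k ord_max j = (j == ord_max)%:R.
  by have /matrixP/(_ 0 j) := kn; rewrite -rowE !mxE eqxx => ->.
have d0 : d != 0.
  apply/eqP => E; have := knE ord_max.
  by rewrite E mul0r eqxx => /esym/eqP; rewrite oner_eq0.
have km j : j != ord_max -> k ord_max j = 0.
  move=> /negPf jm; have /eqP := knE j.
  by rewrite jm mulf_eq0 (negPf d0) => /eqP.
have fw := fund_weight_pred km.
exists p; split=> //.
  rewrite /parabolic /in_frame /= -frameE -/k; split; split => //.
    move=> i j /andP[]; rewrite ltnS leqn0 => /eqP j0 i0.
    have -> : j = ord0 by apply: val_inj.
    rewrite k0E; case: eqP i0 => [->|_ _] //; exact: mulr0.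
  move=> i j /andP[jn ni].
  have -> : i = ord_max by apply/val_inj/eqP; rewrite eqn_leq -ltnS ltn_ord.
  by apply: km; rewrite -val_eqE /= neq_ltn jn.
rewrite /alpha0 /std_alpha0 -frameE fund_weight1 -/k k0E eqxx mulr1; congr (_ * _).
have dkm : d * k ord_max ord_max = 1 by rewrite knE eqxx.
have := congr1 (fun x => d * x) fw; rewrite /= dk mulr1 => <-.
by rewrite mulrCA dkm mulr1.
Qed.

Lemma torus_act (t : 'I_n -> C) g : (forall i, t i != 0) -> \prod_i t i = 1 ->
  SL g -> exists s, [/\ torus h s, SL (s *m g),
    forall i, xv (s *m g) i 0 = t i * xv g i 0
    & forall i, yv (s *m g) 0 i = (t i)^-1 * yv g 0 i].
Proof.
move=> t0 t1 sg; pose D := diag_mx (\row_i t i).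
have sD : SL D.
  by rewrite /SL /= det_diag -[RHS]t1; apply: eq_bigr => i _; rewrite mxE.
have tD : torus h (unframe D).
  split; rewrite -frameE unframeK //.
  exact: diag_mx_is_diag.
have sDg : SL (unframe D *m g).
  by apply: SL_mul => //; rewrite /SL /= det_unframe.
exists (unframe D); split=> // i.
  by rewrite xvM // unframeK // mul_diag_mx !mxE.
have /matrixP/(_ 0 i) := yv_unframe h_unit sg sD.
by rewrite mul_mx_diag !mxE => <-; rewrite mulrC mulfK.
Qed.

Lemma torus_xy s g : torus h s -> SL g -> SL (s *m g) /\
  exists t : 'I_n -> C, [/\ forall i, t i != 0,
    forall i, xv (s *m g) i 0 = t i * xv g i 0
    & forall i, yv (s *m g) 0 i = (t i)^-1 * yv g 0 i].
Proof.
rewrite /torus /in_frame /= -frameE => -[sD /is_diag_mxP dD] sg; pose D := frame s.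
have sE : s = unframe D by rewrite frameK.
have DE : D = diag_mx (\row_i D i i).
  apply/matrixP => i j; rewrite !mxE; case: eqP => [->|/eqP ij]; first by rewrite mulr1n.
  by rewrite mulr0n; apply: dD; rewrite ij.
have SLs : SL s by apply/(SL_frame h_unit).
have ssg : SL (s *m g) by apply: SL_mul.
split=> //; exists (fun i => D i i).
have D0 i : D i i != 0.
  have : \det D != 0 by rewrite [\det D]sD oner_eq0.
  by rewrite DE det_diag => /prodf_neq0/(_ i isT); rewrite mxE -DE.
split=> // i; first by rewrite xvM // -/D DE mul_diag_mx !mxE eqxx mulr1n.
have /matrixP/(_ 0 i) := yv_unframe h_unit sg sD.
rewrite -/D -sE [X in (_ *m X) _ _]DE mul_mx_diag !mxE => <-.
by rewrite mulrC mulfK.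
Qed.

Lemma gpolyfun_frame : mx_alg (@gpolyfun C n) frame.
Proof.
have A := gpolyfun_alg C n.
rewrite (_ : frame = fun g => invmx h *m g *m h); last first.
  by apply: funext => g; rewrite frameE.
apply: (mx_alg_mul A); last exact: (mx_alg_cst A).
by apply: (mx_alg_mul A); [exact: (mx_alg_cst A) | exact: gpolyfun_id].
Qed.

Lemma gpolyfun_xv i : gpolyfun (fun g => xv g i 0).
Proof.
by have := gpolyfun_frame i ord0; congr gpolyfun; apply: funext => g; rewrite xvE.
Qed.

Lemma gpolyfun_yv i : gpolyfun (fun g => yv g 0 i).
Proof.
have := mx_alg_adj (gpolyfun_alg C n) gpolyfun_frame ord_max i.
by congr gpolyfun; apply: funext => g; rewrite yvE.
Qed.

Lemma mx_alg_shear X (D : set (X -> C)) (u : X -> 'cV[C]_n) (v : X -> 'rV[C]_n) (g : X -> 'M[C]_n) :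
  function_algebra D -> mx_alg D u -> mx_alg D v -> mx_alg D g ->
  mx_alg D (fun x => shear h (u x) (v x) (g x)).
Proof.
move=> A Du Dv Dg; apply: (mx_alg_mul A) => //.
apply: (mx_alg_mul A); last exact: (mx_alg_cst A).
apply: (mx_alg_mul A); first exact: (mx_alg_cst A).
apply: (mx_alg_add A); first exact: (mx_alg_cst A).
exact: (mx_alg_mul A).
Qed.

End Flags.

(** * Schubert varieties *)

Section Schubert.
Variables (C : numClosedFieldType) (n0 : nat).
Local Notation n := n0.+2.
Variables (h : 'M[C]_n) (h_unit : h \in unitmx) (w : 'S_n).
Implicit Types (g k p : 'M[C]_n).
Local Notation frame := (frame h).
Local Notation unframe := (unframe h).
Local Notation xv := (xv h).
Local Notation yv := (yv h).
Local Notation shear := (shear h).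
Local Notation schubert := (schubert h w).

Definition x_bound : 'I_n := w ord0.
Definition y_bound : 'I_n := w ord_max.

Definition supported g : Prop :=
  (forall i : 'I_n, (x_bound < i)%N -> xv g i 0 = 0) /\
  (forall i : 'I_n, (i < y_bound)%N -> yv g 0 i = 0).

(** Forward substitution, j by j. It is why B preserves the vanishing of the coordinates of [yv]
    before [y_bound]. *)
Lemma upper_trig_form_support k (v : 'rV[C]_n) c (b : 'I_n) :
  \det k = 1 -> (forall i j : 'I_n, (j < i)%N -> k i j = 0) ->
  v *m k = c *: delta_mx 0 b -> forall j : 'I_n, (j < b)%N -> v 0 j = 0.
Proof.
move=> dk up vk.
have kii i : k i i != 0.
  have : \det k != 0 by rewrite dk oner_eq0.
  by rewrite (det_upper_trig up) => /prodf_neq0/(_ i isT).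
suff H m (j : 'I_n) : (j < m)%N -> (j < b)%N -> v 0 j = 0 by move=> j; apply: (H j.+1).
elim: m j => [//|m IHm] j; rewrite ltnS => le_jm lt_jb.
have /matrixP/(_ 0 j) := vk; rewrite !mxE eqxx /= -val_eqE /= (ltn_eqF lt_jb) mulr0.
rewrite (bigD1 j) //= big1 ?addr0 => [/eqP|i ij].
  by rewrite mulf_eq0 (negPf (kii j)) orbF => /eqP.
have [lt_ij|le_ji] := ltnP i j.
  by rewrite (IHm i (leq_trans lt_ij le_jm) (ltn_trans lt_ij lt_jb)) mul0r.
by rewrite up ?mulr0 // ltn_neqAle le_ji andbT eq_sym val_eqE.
Qed.

Lemma double_coset_supported g : double_coset h w g -> SL g /\ supported g.
Proof.
case=> b [x] [p] [+ + pp ->].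
rewrite /borel /represents /in_frame /= -!frameE => -[sb ub] [sx xw].
have SLb : SL b by apply/(SL_frame h_unit).
have SLx : SL x by apply/(SL_frame h_unit).
have SLbx : SL (b *m x) by apply: SL_mul.
have [c [d [SLp xE yE _]]] := parabolic_act h_unit SLbx pp.
split; first exact: SL_mul.
pose kx := frame x; pose kb := frame b.
have kx_col i : i != x_bound -> kx i ord0 = 0.
  by move=> ia; have := xw i ord0; rewrite (negPf ia) => /negbFE/eqP.
have kx_row j : j != ord_max -> kx y_bound j = 0.
  move=> jm; have := xw y_bound j; rewrite [RHS](inj_eq perm_inj) [RHS]eq_sym (negPf jm).
  by move=> /negbFE/eqP.
have kx_max : kx y_bound ord_max != 0 by rewrite xw.
split=> i Hi.
  rewrite xE mxE xvM // mxE big1 ?mulr0 // => l _.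
  rewrite xvE; have [->|/kx_col->] := eqVneq l x_bound; last by rewrite mulr0.
  by rewrite ub // mul0r.
rewrite yE mxE; have dkb : \det kb = 1 by [].
suff vE : yv (b *m x) *m kb = (kx y_bound ord_max)^-1 *: delta_mx 0 y_bound.
  by rewrite (upper_trig_form_support dkb ub vE) ?mulr0.
have ukx : kx \in unitmx by apply/SL_unit/(SL_frame h_unit).
apply: (can_inj (mulmxK ukx)); rewrite -mulmxA -frameM // yv_frame // -scalemxAl.
apply/matrixP => i' j; rewrite ord1 mxE -rowE !mxE eqxx /=.
by have [->|/kx_row->] := eqVneq j ord_max; rewrite ?mulVf ?mulr0.
Qed.

Lemma schubert_supported g : schubert g -> SL g /\ supported g.
Proof.
move=> [sg clg]; split=> //; split=> i Hi.
  have [p pE] := gpolyfun_xv h i; rewrite pE; apply: clg => x /double_coset_supported.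
  by move=> [_ [H _]]; rewrite -pE H.
have [p pE] := gpolyfun_yv h i; rewrite pE; apply: clg => x /double_coset_supported.
by move=> [_ [_ H]]; rewrite -pE H.
Qed.

(** A polynomial vanishing on the double coset vanishes on the curve off the roots of [delta], hence
    also at 0: limits along curves stay in the closure. *)
Lemma schubert_curve (gamma : C -> 'M[C]_n) (delta : {poly C}) :
  mx_alg (@upolyfun C) gamma -> delta != 0 ->
  (forall s, delta.[s] != 0 -> schubert (gamma s)) -> SL (gamma 0) ->
  schubert (gamma 0).
Proof.
move=> gpoly d0 gS g0; split=> // p p0.
have [r rE] := alg_peval p (upolyfun_alg C) gpoly.
suff r0 : r = 0 by rewrite rE r0 horner0.
apply: (poly_fun_eq0_generic d0) => s /gS[_ clg]; rewrite -rE; exact: clg.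
Qed.

Lemma exists_representative : exists x, represents h w x.
Proof.
(* The sign in the first column corrects the determinant of the permutation matrix to 1. *)
pose W : 'M[C]_n := perm_mx (w^-1)%g *m diag_mx (\row_j if j == ord0 then (-1) ^+ (w^-1)%g else 1).
exists (unframe W); rewrite /represents /in_frame /= -frameE unframeK //; split.
  rewrite /SL /= det_mulmx det_perm det_diag big_ord_recl big1 => [|i _].
    by rewrite mxE eqxx mulr1 -expr2 sqrr_sign.
  by rewrite mxE.
move=> i j; rewrite /W mul_mx_diag !mxE.
have -> : ((w^-1)%g i == j) = (i == w j).
  by apply/eqP/eqP => [<-|->]; rewrite ?permKV ?permK.
case: (i == w j); last by rewrite mul0r eqxx.
by rewrite mul1r; case: ifP => _; rewrite ?signr_eq0 ?oner_eq0.
Qed.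

Lemma upper_trig_mul (k k' : 'M[C]_n) :
  (forall i j : 'I_n, (j < i)%N -> k i j = 0) ->
  (forall i j : 'I_n, (j < i)%N -> k' i j = 0) ->
  forall i j : 'I_n, (j < i)%N -> (k *m k') i j = 0.
Proof.
move=> u u' i j ji; rewrite mxE big1 // => l _.
have [li|il] := ltnP l i; first by rewrite u ?mul0r.
by rewrite u' ?mulr0 // (leq_trans ji).
Qed.

Lemma sum_yx g : SL g -> \sum_i yv g 0 i * xv g i 0 = 0.
Proof.
by move=> /(yv_xv h_unit)/matrixP/(_ 0 0); rewrite !mxE.
Qed.

Lemma representative_flag x : represents h w x ->
  exists c d, [/\ c != 0, d != 0, xv x = c *: delta_mx x_bound 0
                & yv x = d *: delta_mx 0 y_bound].
Proof.
rewrite /represents /in_frame /= -frameE => -[sx xw].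
have SLx : SL x by apply/(SL_frame h_unit).
pose k := frame x.
have k0 : k x_bound ord0 != 0 by rewrite xw.
have km : k y_bound ord_max != 0 by rewrite xw.
exists (k x_bound ord0), (k y_bound ord_max)^-1; split; rewrite ?invr_eq0 //.
  apply/matrixP => i j; rewrite ord1 xvE !mxE eqxx andbT.
  have [->|ia] := eqVneq i x_bound; first by rewrite mulr1.
  by rewrite mulr0; have := xw i ord0; rewrite (negPf ia) => /negbFE/eqP.
apply/esym/yv_uniq => //; rewrite -scalemxAl; apply/matrixP => i j.
rewrite ord1 mxE -rowE !mxE eqxx /=.
have [->|jm] := eqVneq j ord_max; first by rewrite mulVf.
have := xw y_bound j; rewrite [RHS](inj_eq perm_inj) [RHS]eq_sym (negPf jm).
by move=> /negbFE/eqP ->; rewrite mulr0.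
Qed.

(** * Supported matrices as limits of the double coset *)

Section Density.
Hypothesis lt_yx : (y_bound < x_bound)%N.

(** An explicit Bruhat decomposition. [A2] fixes e_a and changes the form e_b into [y2]; then [A1]
    sends e_a to x/x_a, and [y2] is exactly the pullback by [A1] of the normalized form y/y_b. The
    support conditions make [A1] and [A2] upper triangular. *)
Lemma open_cell g : SL g -> supported g -> xv g x_bound 0 != 0 ->
  yv g 0 y_bound != 0 -> double_coset h w g.
Proof.
move=> sg [xs ys]; set xa := xv g _ _ => xa0; set yb := yv g _ _ => yb0.
set a := x_bound; set b := y_bound.
have ab : a != b by rewrite -val_eqE /= gtn_eqF.
have [x0 x0w] := exists_representative.
have := x0w; rewrite /represents /in_frame /= -frameE => -[sx0 xw].
have SLx0 : SL x0 by apply/(SL_frame h_unit).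
pose xi : 'cV[C]_n := xa^-1 *: xv g - delta_mx a 0.
pose y1 : 'rV[C]_n := yb^-1 *: yv g.
pose y2 := y1 + (y1 *m xi) *m delta_mx 0 a.
pose eta : 'rV[C]_n := delta_mx 0 b - y2.
pose A1 : 'M[C]_n := 1%:M + xi *m delta_mx 0 a.
pose A2 : 'M[C]_n := 1%:M + delta_mx b 0 *m eta.
have xia : xi a 0 = 0 by rewrite !mxE !eqxx mulVf // subrr.
have xis (i : 'I_n) : (a < i)%N -> xi i 0 = 0.
  by move=> ai; rewrite !mxE xs // mulr0 -val_eqE gtn_eqF //= subr0.
have y1s (i : 'I_n) : (i < b)%N -> y1 0 i = 0 by move=> ib; rewrite mxE ys // mulr0.
have y1b : y1 0 b = 1 by rewrite mxE mulVf.
have xi1 : (delta_mx 0 a : 'rV[C]_n) *m xi = 0.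
  by apply/matrixP => i j; rewrite !ord1 -rowE mxE xia mxE.
have y2E i : y2 0 i = y1 0 i + (y1 *m xi) 0 0 * (i == a)%:R.
  by rewrite !mxE big_ord1 !mxE eqxx.
have y2s (i : 'I_n) : (i < b)%N -> y2 0 i = 0.
  move=> ib; rewrite y2E y1s // add0r -val_eqE /= ltn_eqF ?mulr0 //.
  exact: ltn_trans ib _.
have y2b : y2 0 b = 1 by rewrite y2E y1b eq_sym (negPf ab) mulr0 addr0.
have etaE i : eta 0 i = (i == b)%:R - y2 0 i by rewrite /eta !mxE eqxx.
have eta1 : eta *m delta_mx b (0 : 'I_1) = 0.
  by apply/matrixP => i j; rewrite !ord1 -colE mxE etaE eqxx y2b subrr mxE.
pose g1 := shear xi (delta_mx 0 a) (shear (delta_mx b 0) eta x0).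
have [c [d [c0 d0 xx0 yx0]]] := representative_flag x0w.
(* This is the incidence relation y x = 0 after normalization. *)
have eta_a : eta 0 a = 0.
  rewrite etaE (negPf ab) y2E eqxx mulr1 sub0r; apply/eqP; rewrite oppr_eq0.
  have -> : y1 0 a + (y1 *m xi) 0 0 = (y1 *m (delta_mx a 0 + xi)) 0 0.
    by rewrite mulmxDr [RHS]mxE -colE [X in _ = X + _]mxE.
  rewrite /xi addrC subrK /y1 -scalemxAl -scalemxAr yv_xv //.
  by rewrite !scaler0 mxE.
have eta_ea : eta *m delta_mx a (0 : 'I_1) = 0.
  by apply/matrixP => i j; rewrite !ord1 -colE mxE eta_a mxE.
have ea_ea : (delta_mx 0 a : 'rV[C]_n) *m delta_mx a 0 = 1%:M :> 'M_1.
  by rewrite mul_delta_mx; apply/matrixP => i j; rewrite !ord1 !mxE.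
have eb_eb : (delta_mx 0 b : 'rV[C]_n) *m delta_mx b 0 = 1%:M :> 'M_1.
  by rewrite mul_delta_mx; apply/matrixP => i j; rewrite !ord1 !mxE.
have SLg' : SL (shear (delta_mx b 0) eta x0) by apply: SL_shear.
have SLg1 : SL g1 by apply: SL_shear.
have xg' : xv (shear (delta_mx b 0) eta x0) = c *: delta_mx a 0.
  by rewrite xv_shear // xx0 -scalemxAr eta_ea scaler0 mulmx0 addr0.
have yg' : yv (shear (delta_mx b 0) eta x0) = d *: y2.
  rewrite yv_shear // yx0 -!scalemxAl eb_eb mul1mx -scalerBr; congr (_ *: _).
  by rewrite /eta opprB addrC subrK.
have xg1 : xv g1 = (c * xa^-1) *: xv g.
  rewrite xv_shear // xg' -scalemxAr ea_ea -scalemxAr mulmx1 -scalerDr.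
  by rewrite addrC subrK scalerA.
have yg1 : yv g1 = (d * yb^-1) *: yv g.
  rewrite yv_shear // yg' -!scalemxAl -scalerBr -scalerA; congr (_ *: _).
  by rewrite {2}/y2 mulmxDl -(mulmxA _ _ xi) xi1 mulmx0 addr0 /y2 addrK.
have k1 : c * xa^-1 != 0 by rewrite mulf_neq0 ?invr_eq0.
have k2 : d * yb^-1 != 0 by rewrite mulf_neq0 ?invr_eq0.
have [||p [pp -> _]] := @same_flag _ _ _ h_unit g1 g (c * xa^-1)^-1 (d * yb^-1)^-1 SLg1 sg.
- by rewrite xg1 scalerA mulVf // scale1r.
- by rewrite yg1 scalerA mulVf // scale1r.
exists (unframe A1 *m unframe A2), x0, p; split=> //; last by rewrite -(mulmxA (unframe A1)).
rewrite /borel /in_frame /= -frameE -unframeM // unframeK //; split.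
  by rewrite /SL /= det_mulmx !det_rank_one_update xi1 eta1 mxE addr0 mulr1.
apply: upper_trig_mul => i j ji; rewrite [LHS]mxE [X in X + _]mxE -val_eqE /= gtn_eqF //;
    rewrite add0r mxE big_ord1 [X in _ * X]mxE.
  have [ja|ja] := eqVneq j a; last by rewrite mulr0.
  by rewrite xis ?mul0r // -ja.
rewrite mxE eqxx andbT; have [ib|ib] := eqVneq i b; last by rewrite mul0r.
have jb : (j < b)%N by rewrite -ib.
have := etaE j; rewrite y2s // subr0 -val_eqE /= ltn_eqF // => etaj.
by move: etaj; rewrite /eta mxE => ->; rewrite mulr0.
Qed.

Lemma elementary_shear (k l : 'I_n) s g : k != l -> SL g ->
  let g' := shear (s *: delta_mx k 0) (delta_mx 0 l) g in
  [/\ SL g', forall i, xv g' i 0 = xv g i 0 + s * xv g l 0 * (i == k)%:R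
    & forall i, yv g' 0 i = yv g 0 i - s * yv g 0 k * (i == l)%:R].
Proof.
move=> kl sg g'.
have vu : (delta_mx 0 l : 'rV[C]_n) *m (s *: delta_mx k 0 : 'cV[C]_n) = 0.
  by rewrite -scalemxAr mul_delta_mx_0 ?scaler0 // eq_sym.
split=> [|i|i]; first exact: SL_shear.
  rewrite xv_shear // mxE -rowE; congr (_ + _).
  by rewrite mxE big_ord1 !mxE eqxx andbT mulrAC.
rewrite yv_shear // mxE; congr (_ + _); rewrite mxE; congr (- _).
by rewrite mxE big_ord1 -scalemxAr -colE !mxE eqxx.
Qed.

Lemma double_coset_schubert g : double_coset h w g -> schubert g.
Proof. by move=> Hg; split; [have [] := double_coset_supported Hg | move=> p; apply]. Qed.

Lemma mx_alg_elementary_shear (k l : 'I_n) g :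
  mx_alg (@upolyfun C) (fun s => shear (s *: delta_mx k 0) (delta_mx 0 l) g).
Proof.
have A := upolyfun_alg C; apply: (mx_alg_shear h A); try exact: (mx_alg_cst A).
by apply: (mx_alg_scale A); [exact: upolyfun_id | exact: (mx_alg_cst A)].
Qed.

Lemma supported_schubert_x g (i : 'I_n) : SL g -> supported g ->
  xv g x_bound 0 != 0 -> (i <= x_bound)%N -> yv g 0 i != 0 -> schubert g.
Proof.
move=> sg gs xa ia yi; have [yb|yb] := eqVneq (yv g 0 y_bound) 0; last first.
  exact/double_coset_schubert/open_cell.
have ib : i != y_bound by apply: contraNneq yi => ->; rewrite yb.
pose gamma s := shear (s *: delta_mx i 0) (delta_mx 0 y_bound) g.
have g0 : gamma 0 = g by rewrite /gamma scale0r shear0l.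
rewrite -g0; pose c := xv g y_bound 0 * (x_bound == i)%:R.
(* Along the curve the coordinate of y at [y_bound] is -s y_i, nonzero for s nonzero; the second
   factor is the coordinate of x at [x_bound], which moves only if i = [x_bound]. *)
pose delta := 'X * ((xv g x_bound 0)%:P + c *: 'X).
apply: (@schubert_curve gamma delta); rewrite ?g0 //.
- exact: mx_alg_elementary_shear.
- rewrite mulf_neq0 ?polyX_eq0 //; apply: contra_neq xa => /(congr1 (horner^~ 0)).
  by rewrite hornerD hornerC hornerZ hornerX mulr0 addr0 horner0.
move=> s; rewrite hornerM hornerX hornerD hornerC hornerZ hornerX mulf_eq0 negb_or.
move=> /andP[s0 sa]; have [sg' xE yE] := elementary_shear s ib sg.
apply/double_coset_schubert/open_cell => //.
- split=> j Hj; [rewrite xE (gs.1 j Hj) | rewrite yE (gs.2 j Hj)].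
    by rewrite add0r -val_eqE /= gtn_eqF ?mulr0 //; apply: leq_ltn_trans Hj.
  by rewrite sub0r -val_eqE /= ltn_eqF // mulr0 oppr0.
- by rewrite xE -mulrA mulrC.
- by rewrite yE yb eqxx mulr1 sub0r oppr_eq0 mulf_neq0.
Qed.

(** The converse of [schubert_supported] where z is nonzero. If x vanishes at [x_bound], a shear
    makes that coordinate s x_i, while y_i stays nonzero for general s; the preceding lemma then
    deals with y in the same way. *)
Lemma supported_schubert g (i : 'I_n) : SL g -> supported g ->
  xv g i 0 * yv g 0 i != 0 -> schubert g.
Proof.
move=> sg gs; rewrite mulf_eq0 negb_or => /andP[xi yi].
have ia : (i <= x_bound)%N by rewrite leqNgt; apply: contra xi => /gs.1->.
have [xa|xa] := eqVneq (xv g x_bound 0) 0; last exact: (@supported_schubert_x _ i).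
have ib : (y_bound <= i)%N by rewrite leqNgt; apply: contra yi => /gs.2->.
have ai : x_bound != i by apply: contraNneq xi => <-; rewrite xa.
pose gamma s := shear (s *: delta_mx x_bound 0) (delta_mx 0 i) g.
have g0 : gamma 0 = g by rewrite /gamma scale0r shear0l.
rewrite -g0; pose delta := 'X * ((yv g 0 i)%:P - (yv g 0 x_bound) *: 'X).
apply: (@schubert_curve gamma delta); rewrite ?g0 //.
- exact: mx_alg_elementary_shear.
- rewrite mulf_neq0 ?polyX_eq0 //; apply: contra_neq yi => /(congr1 (horner^~ 0)).
  by rewrite hornerD hornerN hornerC hornerZ hornerX mulr0 subr0 horner0.
move=> s; rewrite hornerM hornerX hornerD hornerN hornerC hornerZ hornerX mulf_eq0 negb_or.
move=> /andP[s0 sy]; have [sg' xE yE] := elementary_shear s ai sg.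
apply: (@supported_schubert_x _ i) => //.
- split=> j Hj; [rewrite xE (gs.1 j Hj) | rewrite yE (gs.2 j Hj)].
    by rewrite add0r -val_eqE /= gtn_eqF ?mulr0.
  by rewrite sub0r -val_eqE /= ltn_eqF ?mulr0 ?oppr0 //; apply: leq_trans ib.
- by rewrite xE xa eqxx mulr1 add0r mulf_neq0.
- by rewrite yE eqxx mulr1 mulrC.
Qed.

End Density.
End Schubert.

(** * Invariant functions *)

Section InvariantIndices.
Variables (n0 : nat) (w : 'S_n0.+2).
Local Notation n := n0.+2.
Local Notation x_bound := (x_bound w).
Local Notation y_bound := (y_bound w).

(** With truncated subtraction there are no coordinates unless [y_bound < x_bound]; an index of this
    type therefore carries the hypothesis of the density argument. *)
Definition zdim : nat := x_bound - y_bound.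
Definition zindex (j : 'I_zdim) : 'I_n := inord (y_bound + j).

Lemma lt_zdim (j : 'I_zdim) : (j < x_bound - y_bound)%N.
Proof. exact: ltn_ord. Qed.

Lemma zindex_val (j : 'I_zdim) : zindex j = (y_bound + j)%N :> nat.
Proof.
have H1 := ltn_ord x_bound; have H2 := lt_zdim j.
by rewrite /zindex inordK //; lia.
Qed.

Lemma zindex_inj : injective zindex.
Proof. by move=> i j /(congr1 (@nat_of_ord n)); rewrite !zindex_val => /addnI/val_inj. Qed.

Lemma zindex_lt (j : 'I_zdim) : (zindex j < x_bound)%N.
Proof. by have := lt_zdim j; rewrite zindex_val; lia. Qed.

Lemma zdim_gt0 (j : 'I_zdim) : (y_bound < x_bound)%N.
Proof. by have := lt_zdim j; lia. Qed.

Lemma zindexP (i : 'I_n) : (y_bound <= i)%N -> (i < x_bound)%N -> exists j, zindex j = i.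
Proof.
move=> le_bi lt_ia; have lt_j : (i - y_bound < zdim)%N by rewrite /zdim; lia.
exists (Ordinal lt_j); apply: val_inj => /=; rewrite /zindex inordK /= subnKC //.
Qed.

End InvariantIndices.

Section Comparison.
Variables (C : numClosedFieldType) (n0 : nat).
Local Notation n := n0.+2.
Variables (h : 'M[C]_n) (h_unit : h \in unitmx) (w : 'S_n).
Implicit Types (g k p : 'M[C]_n) (V : set 'M[C]_n).
Local Notation xv := (xv h).
Local Notation yv := (yv h).
Local Notation shear := (shear h).
Local Notation schubert := (schubert h w).
Local Notation x_bound := (x_bound w).
Local Notation y_bound := (y_bound w).

Definition zv g (i : 'I_n) : C := xv g i 0 * yv g 0 i.
(** On a Schubert variety [zv g i] vanishes unless [y_bound <= i <= x_bound],
    and the sum over all [i] is zero; so the index [x_bound] is left out. *)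
Definition zcoord g (j : 'I_(zdim w)) : C := zv g (zindex j).
Lemma zv_proportional g g' c : schubert g -> schubert g' ->
  (forall j, zcoord g' j = c * zcoord g j) -> forall i, zv g' i = c * zv g i.
Proof.
move=> /(schubert_supported h_unit)[sg [xs ys]].
move=> /(schubert_supported h_unit)[sg' [xs' ys']] zE.
have key i : i != x_bound -> zv g' i = c * zv g i.
  move=> ia; have [lt_ib|le_bi] := ltnP i y_bound.
    by rewrite /zv ys // ys' // !mulr0.
  have [lt_ai|le_ia] := ltnP x_bound i; first by rewrite /zv xs // xs' // !mul0r mulr0.
  have lt_ia : (i < x_bound)%N by rewrite ltn_neqAle le_ia andbT val_eqE.
  by have [j <-] := zindexP le_bi lt_ia; apply: zE.
have sum0 x : SL x -> zv x x_bound = - \sum_(i | i != x_bound) zv x i.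
  move=> sx; apply/eqP; rewrite -addr_eq0; apply/eqP; rewrite -[RHS](sum_yx h_unit sx).
  rewrite [RHS](bigD1 x_bound) //= /zv [X in X + _]mulrC; congr (_ + _).
  by apply: eq_bigr => i _; rewrite mulrC.
move=> i; have [->|/key//] := eqVneq i x_bound.
by rewrite !sum0 // mulrN mulr_sumr; congr (- _); apply: eq_bigr => j /key.
Qed.

Lemma zv_nonzero g i : schubert g -> zv g i != 0 -> exists j, zcoord g j != 0.
Proof.
move=> Sg zi; apply/not_existsP => H; case/negP: zi.
rewrite (zv_proportional (c := 0) Sg Sg) ?mul0r // => j.
by rewrite mul0r; apply/eqP/negPn/negP; exact: H.
Qed.

(** Curves inside a fibre of z must not leave the domain of a section. The whole Schubert variety
    and the preimages of subsets of the quotient both qualify, so global sections and local frames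
    are treated together. *)
Definition saturated V : Prop := V `<=` schubert /\
  forall g g' c, V g -> schubert g' -> c != 0 -> (exists j, zcoord g j != 0) ->
    (forall j, zcoord g' j = c * zcoord g j) -> V g'.

Lemma saturated_schubert : saturated schubert.
Proof. by split. Qed.

Lemma saturatedW V g g' c : saturated V -> V g -> c != 0 -> (exists j, zcoord g j != 0) ->
  SL g' -> supported h w g' -> (forall j, zcoord g' j = c * zcoord g j) -> V g'.
Proof.
move=> [VS satV] Vg c0 [l zl] sg' sup' zE.
apply: (satV g g' c) => //; last by exists l.
apply: (supported_schubert h_unit (zdim_gt0 l) sg' sup' (i := zindex l)).
by rewrite -/(zv g' (zindex l)) -/(zcoord g' l) zE mulf_neq0.
Qed.

Section InvariantSections.
Variables (V : set 'M[C]_n) (m : nat) (f : 'M[C]_n -> C).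
Hypotheses (fL : L_section h V m f) (fT : T_invariant h V f).
Hypothesis VS : V `<=` schubert.

(** A diagonal matrix of arbitrary determinant acts up to a scalar. *)
Lemma torus_move (t : 'I_n -> C) g : (forall i, t i != 0) -> V g ->
  exists g' c, [/\ SL g', c != 0, f g' = f g,
    forall i, xv g' i 0 = c * t i * xv g i 0
    & forall i, yv g' 0 i = c^-1 * (t i)^-1 * yv g 0 i].
Proof.
move=> t0 Vg; have [sg _] := schubert_supported h_unit (VS Vg).
(* Rescaling by an n-th root of the inverse determinant puts the matrix in T; the factors c and c^-1
   on x and y cancel in alpha_0. *)
pose pt := \prod_i t i; pose c := n.-root pt^-1.
have pt0 : pt != 0 by apply/prodf_neq0 => i _.
have cn : c ^+ n = pt^-1 by rewrite rootCK.
have c0 : c != 0.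
  apply: contra_neq pt0 => cz; apply/eqP; rewrite -invr_eq0 -cn cz.
  by rewrite expr0n.
have [||s [Ts ssg xE yE]] := @torus_act _ _ _ h_unit (fun i => c * t i) g _ _ sg.
- by move=> i; rewrite mulf_neq0.
- by rewrite big_split /= prodr_const card_ord cn mulVf.
exists (s *m g), c; split=> // [|i]; first exact: fT.
by rewrite yE invfM.
Qed.

Lemma f_same_flag g g' c d : V g -> SL g' ->
  (forall i, xv g' i 0 = c * xv g i 0) -> (forall i, yv g' 0 i = d * yv g 0 i) ->
  f g' = (c * d) ^+ m * f g.
Proof.
move=> Vg sg' xE yE; have [sg _] := schubert_supported h_unit (VS Vg).
have [||p [pp -> <-]] := @same_flag _ _ _ h_unit g g' c d sg sg'; last exact: fL.2.
- by apply/matrixP => i j; rewrite ord1 xE mxE.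
- by apply/matrixP => i j; rewrite ord1 yE mxE.
Qed.

(** A diagonal matrix acts on [x] and [y] by a common factor 2, hence on [f] by
    [4 ^+ m], whereas [f] is invariant. *)
Lemma invariant_vanish g : (0 < m)%N -> V g -> (forall i, zv g i = 0) -> f g = 0.
Proof.
move=> m_gt0 Vg z0; have [sg _] := schubert_supported h_unit (VS Vg).
(* Where y_i is nonzero x_i vanishes, so halving there doubles y_i; elsewhere only x_i is
   affected. *)
pose t i : C := if yv g 0 i == 0 then 2 else 2^-1.
have t0 i : t i != 0 by rewrite /t; case: ifP; rewrite ?invr_eq0 pnatr_eq0.
have [g' [c [sg' c0 fg' xE yE]]] := torus_move t0 Vg.
have := @f_same_flag g g' (c * 2) (c^-1 * 2) Vg sg'; rewrite fg'.
have -> : c * 2 * (c^-1 * 2) = 4%:R by rewrite mulrACA mulfV // mul1r -natrM.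
move=> fE; have /eqP : (4%:R ^+ m - 1) * f g = 0.
  rewrite mulrBl mul1r -fE ?subrr // => i.
    rewrite xE /t; case: (eqVneq (yv g 0 i) 0) => [//|yi].
    by have /eqP := z0 i; rewrite mulf_eq0 (negPf yi) orbF => /eqP->; rewrite !mulr0.
  by rewrite yE /t; case: eqP => [->|_]; rewrite ?mulr0 // invrK.
rewrite mulf_eq0 subr_eq0 => /orP[|/eqP//].
by rewrite pexprn_eq1 ?ler0n // pnatr_eq1 orbF => /eqP m0; rewrite m0 in m_gt0.
Qed.

Hypothesis satV : saturated V.

Let nz (P : bool) (x : C) : C := if P then x else 0.

(** [f] does not change when the coordinates [x_i], [y_i] with [x_i y_i = 0] are
    replaced by 0, which is a limit of points of the torus orbit. *)
Lemma degenerate g : V g -> (exists j, zcoord g j != 0) -> exists g0,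
  [/\ V g0, f g0 = f g,
      forall i, xv g0 i 0 = (if zv g i != 0 then xv g i 0 else 0)
    & forall i, yv g0 0 i = (if zv g i != 0 then yv g 0 i else 0)].
Proof.
move=> Vg z_ne0; have [sg [xs ys]] := schubert_supported h_unit (VS Vg).
have [j zj] := z_ne0; pose l := zindex j.
have {zj} zl : zv g l != 0 by [].
have [xl yl] : xv g l 0 != 0 /\ yv g 0 l != 0.
  by apply/andP; rewrite -negb_or -mulf_eq0.
pose xI : 'cV[C]_n := \col_i nz (zv g i != 0) (xv g i 0).
pose xi : 'cV[C]_n := \col_i nz (zv g i == 0) (xv g i 0).
pose yI : 'rV[C]_n := \row_i nz (zv g i != 0) (yv g 0 i).
pose eta : 'rV[C]_n := \row_i nz (zv g i == 0) (yv g 0 i).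
have xE : xv g = xI + xi.
  apply/matrixP => i k; rewrite ord1 !mxE /nz.
  by case: (zv g i == 0); rewrite ?addr0 ?add0r.
have yE : yv g = yI + eta.
  apply/matrixP => k i; rewrite ord1 !mxE /nz.
  by case: (zv g i == 0); rewrite ?addr0 ?add0r.
(* [u] and [v] read off index [l], where z is nonzero, normalized to be 1 on [xI] and [yI] and 0 on
   [xi] and [eta]; shears along them move the parts with z_i = 0 and nothing else. *)
pose u : 'rV[C]_n := (xv g l 0)^-1 *: delta_mx 0 l.
pose v : 'cV[C]_n := (yv g 0 l)^-1 *: delta_mx l 0.
have uxI : u *m xI = 1%:M.
  apply/matrixP => k1 k2; rewrite !ord1 -scalemxAl mxE -rowE !mxE zl /nz.
  by rewrite mulVf.
have uxi : u *m xi = 0.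
  apply/matrixP => k1 k2; rewrite !ord1 -scalemxAl mxE -rowE !mxE (negPf zl).
  by rewrite mulr0.
have yIv : yI *m v = 1%:M.
  apply/matrixP => k1 k2; rewrite !ord1 -scalemxAr mxE -colE !mxE zl /nz.
  by rewrite mulVf.
have etav : eta *m v = 0.
  apply/matrixP => k1 k2; rewrite !ord1 -scalemxAr mxE -colE !mxE (negPf zl).
  by rewrite mulr0.
have pair0 (a b : 'I_n -> C) : (forall i, a i * b i = 0) ->
    (\row_i a i) *m (\col_i b i) = 0 :> 'M[C]_1.
  move=> ab0; apply/matrixP => k1 k2; rewrite !ord1 !mxE big1 // => i _.
  by rewrite !mxE ab0.
have yIxi : yI *m xi = 0.
  by apply: pair0 => i; rewrite /nz; case: (zv g i == 0); rewrite ?mulr0 ?mul0r.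
have etaxI : eta *m xI = 0.
  by apply: pair0 => i; rewrite /nz; case: (zv g i == 0); rewrite ?mulr0 ?mul0r.
have etaxi : eta *m xi = 0.
  apply: pair0 => i; rewrite /nz; case: eqP => [zi|]; rewrite ?mulr0 //.
  by rewrite mulrC.
pose g1 := shear (- xi) u g.
have uxiN : u *m (- xi) = 0 by rewrite mulmxN uxi oppr0.
have sg1 : SL g1 by apply: SL_shear.
have xg1 : xv g1 = xI.
  by rewrite xv_shear // xE mulmxDr uxI uxi addr0 mulmx1 addrK.
have yg1 : yv g1 = yv g.
  have yxi : yv g *m xi = 0 by rewrite yE mulmxDl yIxi etaxi addr0.
  by rewrite yv_shear // mulmxN yxi oppr0 mul0mx subr0.
pose g0 := shear v eta g1.
have sg0 : SL g0 by apply: SL_shear.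
have xg0 : xv g0 = xI by rewrite xv_shear // xg1 etaxI mulmx0 addr0.
have yg0 : yv g0 = yI.
  by rewrite yv_shear // yg1 yE mulmxDl yIv etav addr0 mul1mx addrK.
(* The curve scales [xi] and [eta] by s; it ends at [g0] for s = 0 and leaves z unchanged. *)
pose gamma s := shear (s *: xi) u (shear (- s *: v) eta g0).
have gammaE s : [/\ SL (gamma s), xv (gamma s) = xI + s *: xi & yv (gamma s) = yI + s *: eta].
  have e1 : eta *m (- s *: v) = 0 by rewrite -scalemxAr etav scaler0.
  have e2 : u *m (s *: xi) = 0 by rewrite -scalemxAr uxi scaler0.
  have s1 : SL (shear (- s *: v) eta g0) by apply: SL_shear.
  have x1 : xv (shear (- s *: v) eta g0) = xI.
    by rewrite xv_shear // xg0 etaxI mulmx0 addr0.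
  have y1 : yv (shear (- s *: v) eta g0) = yI + s *: eta.
    by rewrite yv_shear // yg0 -scalemxAr yIv -scalemxAl mul1mx scaleNr opprK.
  split; first exact: SL_shear.
    by rewrite xv_shear // x1 uxI mulmx1.
  have yxi : (yI + s *: eta) *m xi = 0.
    by rewrite mulmxDl -scalemxAl yIxi etaxi scaler0 addr0.
  by rewrite yv_shear // y1 -(scalemxAr s) yxi scaler0 mul0mx subr0.
have gamma0 : gamma 0 = g0 by rewrite /gamma oppr0 !scale0r !shear0l.
have zv_gamma s i : zv (gamma s) i = zv g i.
  have [_ xs1 ys1] := gammaE s; rewrite /zv xs1 ys1 !mxE /nz -/(zv g i).
  case: eqP => zi /=; last by rewrite !mulr0 !addr0.
  by rewrite !add0r mulrACA -/(zv g i) zi mulr0.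
have Vgamma s : V (gamma s).
  have [ss xs1 ys1] := gammaE s.
  apply: (saturatedW (c := 1) satV Vg) => //; rewrite ?oner_eq0 //.
    split=> i Hi; rewrite ?xs1 ?ys1 !mxE /nz ?(xs i Hi) ?(ys i Hi);
      by rewrite !if_same mulr0 addr0.
  by move=> k; rewrite mul1r; apply: zv_gamma.
have fgamma s : s != 0 -> f (gamma s) = f g.
  move=> s0; have [ss xs1 ys1] := gammaE s.
  (* For s nonzero a diagonal matrix does the same: s acts on x_i where y_i = 0, and s^-1, hence s
     on y_i, where x_i = 0. *)
  pose t i := if zv g i != 0 then 1 else if yv g 0 i == 0 then s else s^-1.
  have t0 i : t i != 0.
    by rewrite /t; case: ifP => _; rewrite ?oner_eq0 //; case: ifP; rewrite ?invr_eq0.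
  have [g2 [c [sg2 c0 fg2 x2 y2]]] := torus_move t0 Vg.
  have zg2 i : zv g2 i = zv g i.
    rewrite /zv x2 y2 -(mulrA c) -(mulrA c^-1) mulrACA mulfV // mul1r mulrACA.
    by rewrite mulfV // mul1r.
  have Vg2 : V g2.
    apply: (saturatedW (c := 1) satV Vg) => //; rewrite ?oner_eq0 //.
      by split=> i Hi; rewrite ?x2 ?y2 ?(xs i Hi) ?(ys i Hi) mulr0.
    by move=> k; rewrite mul1r; apply: zg2.
  rewrite -fg2 (@f_same_flag g2 (gamma s) c^-1 c Vg2 ss).
  - by rewrite mulVf // expr1n mul1r.
  - move=> i; rewrite x2 !mulrA mulVf // mul1r xs1 !mxE /nz /t.
    case: eqP => [zi|_] /=; last by rewrite mulr0 addr0 mul1r.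
    rewrite add0r; case: eqP => // /eqP yi; have /eqP := zi.
    by rewrite mulf_eq0 (negPf yi) orbF => /eqP->; rewrite !mulr0.
  - move=> i; rewrite y2 !mulrA mulfV // mul1r ys1 !mxE /nz /t.
    case: eqP => [zi|_] /=; last by rewrite mulr0 addr0 invr1 mul1r.
    by rewrite add0r; case: eqP => [->|_]; rewrite ?mulr0 ?invrK.
have Vg0 : V g0 by rewrite -gamma0.
exists g0; split=> // [|i|i]; last 2 first.
- by rewrite xg0 mxE.
- by rewrite yg0 mxE.
have [p [q [q0 fpq]]] := fL.1 g0 Vg0.
have A := upolyfun_alg C.
have gpoly : mx_alg (@upolyfun C) gamma.
  apply: (mx_alg_shear h A); try exact: (mx_alg_cst A).
    by apply: (mx_alg_scale A); [exact: upolyfun_id | exact: (mx_alg_cst A)].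
  apply: (mx_alg_shear h A); try exact: (mx_alg_cst A).
  apply: (mx_alg_scale A); last exact: (mx_alg_cst A).
  by apply: (alg_opp A); exact: upolyfun_id.
have [[P PE] [Q QE]] := (alg_peval p A gpoly, alg_peval q A gpoly).
have Q0 : Q != 0.
  by apply/eqP => Q0; apply: q0; rewrite -gamma0 QE Q0 horner0.
(* On the curve [f] is P/Q and equals [f g] for general s; the identity persists at s = 0, where Q
   does not vanish. *)
have : P - f g *: Q = 0.
  apply: (@poly_fun_eq0_generic _ _ ('X * Q)); first by rewrite mulf_neq0 ?polyX_eq0.
  move=> s; rewrite hornerM hornerX mulf_eq0 negb_or => /andP[s0]; rewrite -QE => /eqP qs.
  rewrite hornerD hornerN hornerZ -PE -QE -(fgamma s s0) (fpq _ (Vgamma s) qs).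
  by rewrite divfK ?subrr //; apply/eqP.
move=> /(congr1 (horner^~ 0)); rewrite hornerD hornerN hornerZ -PE -QE gamma0 horner0.
move/eqP; rewrite subr_eq0 => /eqP pE.
by rewrite (fpq _ Vg0 q0) pE mulfK //; apply/eqP.
Qed.

(** After degeneration the vectors and forms of both points are supported exactly where z is
    nonzero. A diagonal matrix then carries one vector to the other, and the ratio of the forms is
    forced by the ratio c of the z. *)
Lemma comparison g g' c : V g -> V g' -> c != 0 -> (exists j, zcoord g j != 0) ->
  (forall j, zcoord g' j = c * zcoord g j) -> f g' = c ^+ m * f g.
Proof.
move=> Vg Vg' c0 z_ne0 zE.
have zvE := zv_proportional (VS Vg) (VS Vg') zE.
have z_ne0' : exists j, zcoord g' j != 0.
  by have [j zj] := z_ne0; exists j; rewrite zE mulf_neq0.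
have [g0 [Vg0 <- x0 y0]] := degenerate Vg z_ne0.
have [g0' [Vg0' <- x0' y0']] := degenerate Vg' z_ne0'.
have [sg0 [xs0 ys0]] := schubert_supported h_unit (VS Vg0).
have [sg0' _] := schubert_supported h_unit (VS Vg0').
pose t i := if zv g i != 0 then xv g' i 0 / xv g i 0 else 1.
have nz_xy x i : zv x i != 0 -> xv x i 0 != 0 /\ yv x 0 i != 0.
  by move=> zi; apply/andP; rewrite -negb_or -mulf_eq0.
have zv' i : (zv g' i != 0) = (zv g i != 0) by rewrite zvE mulf_eq0 (negPf c0).
have t0 i : t i != 0.
  rewrite /t; case: ifP => zi; rewrite ?oner_eq0 //.
  have [xi _] := nz_xy g i zi; have [xi' _] : xv g' i 0 != 0 /\ yv g' 0 i != 0.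
    by apply: nz_xy; rewrite zv'.
  by rewrite mulf_neq0 // invr_eq0.
have [g1 [k [sg1 k0 fg1 x1 y1]]] := torus_move t0 Vg0.
have zg0 i : zv g0 i = zv g i.
  by rewrite /zv x0 y0 -/(zv g i); case: eqP => [->|] //=; rewrite mulr0.
have zg1 i : zv g1 i = zv g i.
  rewrite -zg0 /zv x1 y1 -(mulrA k) -(mulrA k^-1) mulrACA mulfV // mul1r mulrACA.
  by rewrite mulfV // mul1r.
have Vg1 : V g1.
  apply: (saturatedW (c := 1) satV Vg) => //; rewrite ?oner_eq0 //.
    by split=> i Hi; rewrite ?x1 ?y1 ?(xs0 i Hi) ?(ys0 i Hi) mulr0.
  by move=> j; rewrite mul1r; apply: zg1.
rewrite -fg1 (@f_same_flag g1 g0' k^-1 (k * c) Vg1 sg0') ?mulKf //.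
- move=> i; rewrite x1 !mulrA mulVf // mul1r x0' x0 zv' /t.
  by case: ifP => zi; rewrite ?mulr0 // divfK //; have [] := nz_xy g i zi.
- move=> i; rewrite y1 y0' y0 zv' /t; case: ifP => zi; last by rewrite !mulr0.
  have [xi yi] := nz_xy g i zi; have [xi' _] : xv g' i 0 != 0 /\ yv g' 0 i != 0.
    by apply: nz_xy; rewrite zv'.
  apply: (mulfI xi'); rewrite -/(zv g' i) zvE /zv invf_div.
  by field; rewrite xi' k0.
Qed.

End InvariantSections.

End Comparison.

(** * Slices *)

Section Slices.
Variables (C : numClosedFieldType) (n0 : nat).
Local Notation n := n0.+2.
Variables (h : 'M[C]_n) (h_unit : h \in unitmx) (w : 'S_n).
Implicit Types (g k p : 'M[C]_n).
Local Notation frame := (frame h).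
Local Notation unframe := (unframe h).
Local Notation xv := (xv h).
Local Notation yv := (yv h).
Local Notation shear := (shear h).
Local Notation schubert := (schubert h w).
Local Notation x_bound := (x_bound w).
Local Notation y_bound := (y_bound w).
Local Notation d := (zdim w).
Local Notation zc := (zcoord h (w:=w)).
Local Notation zindex := (@zindex n0 w).

Lemma exists_dual_row (x : 'cV[C]_n) (i0 : 'I_n) : x != 0 ->
  exists r : 'rV[C]_n, r 0 i0 = 1 /\ (r *m x) 0 0 != 0.
Proof.
move=> x0; have [xi0|xi0] := eqVneq (x i0 0) 0; last first.
  by exists (delta_mx 0 i0); rewrite -rowE !mxE !eqxx.
have [i xi] : exists i, x i 0 != 0.
  apply/not_existsP => H; case/eqP: x0; apply/matrixP => i j; rewrite ord1 mxE.
  by apply/eqP/negPn/negP; exact: H.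
exists (delta_mx 0 i0 + delta_mx 0 i); split.
  rewrite !mxE !eqxx /=; case: eqP => [E|_]; last by rewrite addr0.
  by move: xi; rewrite -E xi0 eqxx.
by rewrite mulmxDl -!rowE !mxE xi0 add0r.
Qed.

(** Two rank one updates of the identity: [k1] sends e_0 to x, and [k2] fixes e_0, as y x = 0, while
    turning y k1 into the last coordinate form. The dual rows are chosen to keep the determinants
    nonzero. *)
Lemma exists_flag (x : 'cV[C]_n) (y : 'rV[C]_n) : x != 0 -> y != 0 -> y *m x = 0 ->
  exists k, [/\ k \in unitmx, col ord0 k = x & y *m k = delta_mx 0 ord_max].
Proof.
move=> x0 y0 yx.
pose e0 : 'cV[C]_n := delta_mx ord0 0; pose em : 'rV[C]_n := delta_mx 0 ord_max.
have [r [r0 rx]] := exists_dual_row ord0 x0.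
have re0 : r *m e0 = 1%:M.
  by apply/matrixP => i j; rewrite !ord1 -colE !mxE eqxx r0.
pose k1 := 1%:M + (x - e0) *m r.
have k1e : k1 *m e0 = x by rewrite mulmxDl mul1mx -mulmxA re0 mulmx1 addrC subrK.
have uk1 : k1 \in unitmx.
  have E : (r *m (x - e0)) 0 0 = (r *m x) 0 0 - 1.
    by rewrite mulmxBr re0 mxE; congr (_ + _); rewrite !mxE eqxx.
  by rewrite unitmxE det_rank_one_update E addrC subrK unitfE.
pose y1 := y *m k1.
have y10 : y1 *m e0 = 0 by rewrite -mulmxA k1e.
have y1n0 : y1^T != 0.
  rewrite trmx_eq0; apply: contra_neq y0 => y1z.
  by apply: (can_inj (mulmxK uk1)); rewrite -/y1 y1z mul0mx.
have [u' [um yu]] := exists_dual_row ord_max y1n0.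
pose c := (u' *m y1^T) 0 0.
pose u : 'cV[C]_n := c^-1 *: u'^T.
have y1u : y1 *m u = 1%:M.
  apply/matrixP => i j; rewrite !ord1 -scalemxAr mxE -{1}(trmxK y1) -trmx_mul.
  by rewrite [X in _ * X]mxE mulVf // !mxE.
pose k2 := 1%:M + u *m (em - y1).
have k2e : k2 *m e0 = e0.
  rewrite mulmxDl mul1mx -mulmxA mulmxBl y10 subr0 mul_delta_mx_0 ?mulmx0 ?addr0 //.
have y1k2 : y1 *m k2 = em.
  by rewrite mulmxDr mulmx1 mulmxA y1u mul1mx addrC subrK.
have uk2 : k2 \in unitmx.
  have E : ((em - y1) *m u) 0 0 = c^-1 - 1.
    rewrite mulmxBl y1u mxE; congr (_ + _); last by rewrite !mxE eqxx.
    by rewrite -scalemxAr mxE -rowE !mxE um mulr1.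
  by rewrite unitmxE det_rank_one_update E addrC subrK unitfE invr_eq0.
exists (k1 *m k2); split; first by rewrite unitmx_mul uk1.
  by rewrite colE -mulmxA k2e.
by rewrite mulmxA -/y1 y1k2.
Qed.

Lemma exists_lift (x : 'cV[C]_n) (y : 'rV[C]_n) : x != 0 -> y != 0 -> y *m x = 0 ->
  exists g c, [/\ SL g, c != 0, xv g = c *: x & yv g = c^-1 *: y].
Proof.
move=> x0 y0 yx; have [k [uk kx yk]] := exists_flag x0 y0 yx.
(* A square root, since both the first and the last column are scaled; x and y then acquire inverse
   factors and the products x_i y_i are unchanged. *)
pose c := sqrtC (\det k)^-1.
have dk : \det k != 0 by rewrite -unitfE -unitmxE.
have cc : c ^+ 2 = (\det k)^-1 by rewrite sqrtCK.
have c0 : c != 0.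
  by apply: contra_neq dk => cz; apply/eqP; rewrite -invr_eq0 -cc cz expr0n.
pose D : 'M[C]_n := diag_mx (\row_j if (j == ord0) || (j == ord_max) then c else 1).
have D0 : D *m delta_mx ord0 (0 : 'I_1) = c *: delta_mx ord0 0.
  apply/matrixP => i j; rewrite mul_diag_mx !mxE; have [->|] := eqVneq i ord0 => //=.
  by rewrite !mulr0.
have Dm : delta_mx (0 : 'I_1) ord_max *m D = c *: delta_mx 0 ord_max.
  apply/matrixP => i j; rewrite mul_mx_diag !mxE ord1 eqxx /=.
  have [->|] := eqVneq j ord_max; first by rewrite orbT mulrC.
  by rewrite mulr0 mul0r.
have sg : SL (unframe (k *m D)).
  rewrite /SL /= det_unframe // det_mulmx det_diag (bigD1 ord0) //= (bigD1 ord_max) //=.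
  rewrite big1 => [|i /andP[i0 im]]; last by rewrite mxE (negPf i0) (negPf im).
  by rewrite !mxE !eqxx orbT mulr1 -expr2 cc mulfV.
exists (unframe (k *m D)), c; split=> //.
  by rewrite xv_frame unframeK // -mulmxA D0 -scalemxAr -colE kx.
apply/esym/yv_uniq => //; rewrite unframeK // -scalemxAl mulmxA yk Dm scalerA.
by rewrite mulVf // scale1r.
Qed.

(** A linear section of z: with x equal to 1 on the whole range, y carries the coordinates z, and
    its entry at [x_bound] is minus their sum so that y x = 0. *)
Definition xhat : 'cV[C]_n := \col_i ((y_bound <= i <= x_bound)%N)%:R.
Definition yhat (z : 'I_d -> C) : 'rV[C]_n :=
  \sum_j z j *: (delta_mx 0 (zindex j) - delta_mx 0 x_bound).

Lemma zindex_neq (j : 'I_d) : (zindex j == x_bound) = false.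
Proof. by rewrite -val_eqE /= ltn_eqF // zindex_lt. Qed.

Lemma yhat_zindex z j : yhat z 0 (zindex j) = z j.
Proof.
rewrite /yhat summxE (bigD1 j) //= big1 => [|i ij].
  by rewrite !mxE !eqxx zindex_neq subr0 mulr1 addr0.
have zij : (zindex j == zindex i) = false.
  by rewrite (inj_eq (@zindex_inj _ w)) eq_sym (negPf ij).
by rewrite !mxE zij zindex_neq andbF subr0 mulr0.
Qed.

Lemma yhat_support z (i : 'I_n) : (i < y_bound)%N -> yhat z 0 i = 0.
Proof.
move=> ib; rewrite /yhat summxE big1 // => j _; rewrite !mxE eqxx /= -!val_eqE /=.
have lt_i : (i < zindex j)%N by rewrite zindex_val (leq_trans ib) // leq_addr.
by rewrite !ltn_eqF ?subrr ?mulr0 // (ltn_trans lt_i) // zindex_lt.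
Qed.

Lemma yhat_xhat z : yhat z *m xhat = 0.
Proof.
rewrite /yhat mulmx_suml big1 // => j _; rewrite -scalemxAl mulmxBl -!rowE.
have lt_j := zindex_lt j; have := zindex_val j => zj.
suff -> : row (zindex j) xhat - row x_bound xhat = 0 by rewrite scaler0.
apply/matrixP => i k; rewrite !mxE leqnn andbT (ltnW lt_j) zj leq_addr.
by rewrite (ltnW (zdim_gt0 j)) subrr.
Qed.

Lemma xhat_zindex j : xhat (zindex j) 0 = 1.
Proof. by rewrite mxE (ltnW (zindex_lt j)) zindex_val leq_addr. Qed.

Lemma xhat_support (i : 'I_n) : (x_bound < i)%N -> xhat i 0 = 0.
Proof. by move=> ai; rewrite mxE leqNgt [(i <= _)%N]leqNgt ai andbF. Qed.

Lemma hat_schubert g c z : (exists j, z j != 0) -> SL g -> c != 0 ->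
  xv g = c *: xhat -> yv g = c^-1 *: yhat z -> schubert g /\ forall j, zc g j = z j.
Proof.
move=> [l zl] sg c0 xE yE.
have zE j : zc g j = z j.
  rewrite /zcoord /zv xE yE [X in X * _]mxE [X in _ * X]mxE yhat_zindex xhat_zindex.
  by rewrite mulr1 mulrA mulfV // mul1r.
split=> //; apply: (supported_schubert h_unit (zdim_gt0 l) sg _ (i := zindex l)).
  split=> i Hi; first by rewrite xE mxE xhat_support // mulr0.
  by rewrite yE mxE yhat_support // mulr0.
by rewrite -[X in X != 0]/(zc g l) zE.

Qed.
Lemma hat_neq0 z : (exists j, z j != 0) -> xhat != 0 /\ yhat z != 0.
Proof.
move=> [l zl]; split.
  apply: contra_neq (oner_neq0 C) => x0.
  by rewrite -(xhat_zindex l) x0 mxE.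
by apply: contra_neq zl => y0; rewrite -(yhat_zindex z l) y0 mxE.
Qed.

Lemma zc_surjective z : (exists j, z j != 0) ->
  exists2 g, schubert g & zc g = z.
Proof.
move=> z0; have [x0 y0] := hat_neq0 z0.
have [g [c [sg c0 xE yE]]] := exists_lift x0 y0 (yhat_xhat z).
by have [Sg zE] := hat_schubert z0 sg c0 xE yE; exists g => //; apply: funext.
Qed.

Lemma mx_alg_yhat : mx_alg (@mpolyfun C d) yhat.
Proof.
have A := mpolyfun_alg C d; move=> i k.
rewrite (_ : (fun _ => _) = fun z : 'I_d -> C =>
  \sum_j z j * (delta_mx 0 (zindex j) - delta_mx 0 x_bound : 'rV[C]_n) i k).
  by apply: (alg_sum A) => j _; apply: (alg_mul A); [exact: mpolyfun_proj | exact: (alg_cst A)].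
by apply: funext => z; rewrite summxE; apply: eq_bigr => j _; rewrite mxE.
Qed.

(** Polynomial slice over the affine chart [z_l = 1]: a shear by
    [yhat z - yhat e_l] of a fixed lift of the point [e_l]. *)
Lemma exists_slice (l : 'I_d) : exists2 G : ('I_d -> C) -> 'M[C]_n,
  mx_alg (@mpolyfun C d) G &
  forall z, z l = 1 -> schubert (G z) /\ zc (G z) = z.
Proof.
pose el : 'I_d -> C := fun j => (j == l)%:R.
have el0 : exists j, el j != 0 by exists l; rewrite /el eqxx oner_eq0.
have [x0 y0] := hat_neq0 el0.
have [g [c [sg c0 xE yE]]] := exists_lift x0 y0 (yhat_xhat el).
(* On the chart both [yhat z] and [yhat el] are 1 at [zindex l], so the shear replaces one form by
   the other; it fixes the vector because both forms kill [xhat]. *)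
pose G z := shear (- delta_mx (zindex l) 0) (yhat z - yhat el) g.
exists G.
  have A := mpolyfun_alg C d.
  apply: (mx_alg_shear h A); try exact: (mx_alg_cst A).
  by apply: (mx_alg_sub A); [exact: mx_alg_yhat | exact: (mx_alg_cst A)].
move=> z zl.
have z0 : exists j, z j != 0 by exists l; rewrite zl oner_eq0.
have vu : (yhat z - yhat el) *m (- delta_mx (zindex l) 0 : 'cV[C]_n) = 0.
  apply/matrixP => i j; rewrite mulmxN !ord1 -colE.
  by rewrite mxE mxE mxE [X in _ + X]mxE !yhat_zindex zl /el eqxx subrr oppr0 mxE.
have sG : SL (G z) by apply: SL_shear.
have xG : xv (G z) = c *: xhat.
  by rewrite xv_shear // xE -scalemxAr mulmxBl !yhat_xhat subr0 scaler0 mulmx0 addr0.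
have yG : yv (G z) = c^-1 *: yhat z.
  rewrite yv_shear // yE -scalemxAl mulmxN -colE.
  have -> : col (zindex l) (yhat el) = 1%:M.
    by apply/matrixP => i j; rewrite !ord1 mxE yhat_zindex /el eqxx !mxE.
  rewrite scalerN mulNmx opprK -scalemxAl mul1mx -scalerDr.
  by rewrite addrC subrK.
by have [SG zG] := hat_schubert z0 sG c0 xG yG; split=> //; apply: funext.
Qed.

Lemma gpolyfun_zc j : gpolyfun (fun g => zc g j).
Proof.
apply: (alg_mul (gpolyfun_alg C n)); first exact: gpolyfun_xv.
exact: gpolyfun_yv.
Qed.

Lemma homog_invariant_section m (P : {mpoly C[d]}) : P \is m.-homog ->
  invariant_section h w m (fun g => P.@[zc g]).
Proof.
move=> Ph; split; last first.
  move=> t x tt /(schubert_supported h_unit)[sx _]; congr (P.@[_]).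
  have [_ [s [s0 xE yE]]] := torus_xy h_unit tt sx.
  by apply: funext => j; rewrite /zcoord /zv xE yE mulrACA mulfV // mul1r.
split.
  move=> x _; have [p pE] : gpolyfun (fun g => P.@[zc g]).
    by apply: (alg_meval (gpolyfun_alg C n)) => j; apply: gpolyfun_zc.
  have peval1 y : @peval C n 1 y = 1 by rewrite /peval meval1.
  exists p, 1; rewrite peval1; split; first by apply/eqP; rewrite oner_eq0.
  by move=> y _ _; rewrite pE peval1 divr1.
move=> x p /(schubert_supported h_unit)[sx _] pp.
have [c [d' [_ xE yE ->]]] := parabolic_act h_unit sx pp.
rewrite -(meval_homog _ _ Ph); congr (P.@[_]); apply: funext => j.
by rewrite /zcoord /zv xE yE [X in X * _]mxE [X in _ * X]mxE mulrACA.
Qed.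

End Slices.

Section Homogenization.
Variables (C : fieldType) (d : nat).

Lemma homogenize (P : {mpoly C[d]}) (l : 'I_d) N : (msize P <= N.+1)%N ->
  exists2 H : {mpoly C[d]}, H \is N.-homog &
    forall z, z l != 0 -> H.@[z] = z l ^+ N * P.@[fun j => (z l)^-1 * z j].
Proof.
move=> sP; exists (\sum_(k < N.+1) pihomog mdeg k P * 'X_l ^+ (N - k)).
  apply: rpred_sum => k _; have le_kN : (k <= N)%N by rewrite -ltnS.
  suff : pihomog mdeg k P * 'X_l ^+ (N - k) \is (k + (N - k)).-homog by rewrite subnKC.
  apply: dhomogM; first exact: pihomogP.
  have Xh : 'X_l \is [in C[d], 1.-homog] by rewrite dhomogX /= mdeg1.
  by have := dhomogMn (N - k) Xh; rewrite mul1n.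
move=> z zl; rewrite [P in RHS](@pihomog_partitionE _ _ mdeg N.+1) //.
rewrite !raddf_sum mulr_sumr /=; apply: eq_bigr => k _.
have le_kN : (k <= N)%N by rewrite -ltnS.
rewrite mevalM rmorphXn /= mevalXU (meval_homog _ _ (pihomogP _ _ _)).
rewrite mulrA mulrC; congr (_ * _).
have -> : z l ^+ N = z l ^+ (N - k) * z l ^+ k by rewrite -exprD subnK.
by rewrite exprVn mulfK // expf_neq0.
Qed.

End Homogenization.

(** * Sections as quotients of forms, and points of the quotient *)

Section LocalForm.
Variables (C : numClosedFieldType) (n0 : nat).
Local Notation n := n0.+2.
Variables (h : 'M[C]_n) (h_unit : h \in unitmx) (w : 'S_n).
Implicit Types (g x : 'M[C]_n) (V : set 'M[C]_n).
Local Notation schubert := (schubert h w).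
Local Notation d := (zdim w).
Local Notation zc := (zcoord h (w:=w)).

(** On a slice [f] is a quotient of polynomials, which is then homogenized. *)
Lemma local_homog_rational V m f x0 : saturated h w V -> L_section h V m f ->
  T_invariant h V f -> V x0 -> (exists j, zc x0 j != 0) ->
  exists e (P Q : {mpoly C[d]}), [/\ P \is (m + e).-homog, Q \is e.-homog,
    Q.@[zc x0] != 0 &
    forall x, V x -> Q.@[zc x] != 0 -> f x = P.@[zc x] / Q.@[zc x]].
Proof.
move=> satV fL fT Vx0 [l zl]; have VS := satV.1.
have [G Gpoly GE] := exists_slice h_unit l.
pose norm (z : 'I_d -> C) j := (z l)^-1 * z j.
have norml z : z l != 0 -> norm z l = 1 by move=> z0; rewrite /norm mulVf.
have VG x : V x -> zc x l != 0 -> V (G (norm (zc x))) /\ f x = zc x l ^+ m * f (G (norm (zc x))).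
  move=> Vx xl; have [SG zG] := GE _ (norml _ xl).
  have VGx : V (G (norm (zc x))).
    apply: (satV.2 x _ (zc x l)^-1) => //; first by rewrite invr_eq0.
      by exists l.
    by move=> j; rewrite zG.
  split=> //; apply: (comparison h_unit fL fT VS satV) => //.
    by exists l; rewrite zG norml // oner_eq0.
  by move=> j; rewrite zG /norm mulVKf.
have [VG0 _] := VG _ Vx0 zl.
have [p [q [q0 fpq]]] := fL.1 _ VG0.
have A := mpolyfun_alg C d.
have [[P PE] [Q QE]] := (alg_peval p A Gpoly, alg_peval q A Gpoly).
pose N := maxn (msize P) (msize Q).
have [|HP HPh HPE] := @homogenize _ _ P l N; first by rewrite leqW // leq_maxl.
have [|HQ HQh HQE] := @homogenize _ _ Q l N; first by rewrite leqW // leq_maxr.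
have Xh : 'X_l \is [in C[d], 1.-homog] by rewrite dhomogX /= mdeg1.
(* The extra factor ['X_l] in both forms makes nonvanishing of the denominator imply that the point
   lies in the chart of the slice. *)
exists N.+1, ('X_l ^+ m.+1 * HP), ('X_l * HQ); split.
- rewrite addnS -addSn; apply: dhomogM => //.
  by have := dhomogMn m.+1 Xh; rewrite mul1n.
- by rewrite -add1n; apply: dhomogM.
- have Q0 : Q.@[norm (zc x0)] != 0 by rewrite -QE; apply/eqP.
  rewrite mevalM mevalXU HQE //; apply: mulf_neq0 => //; apply: mulf_neq0 => //.
  exact: expf_neq0.
move=> x Vx; rewrite mevalM mevalXU mulf_eq0 negb_or => /andP[xl].
rewrite HQE // mulf_eq0 negb_or => /andP[xN Qx].
have [VGx ->] := VG _ Vx xl.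
have qx : peval q (G (norm (zc x))) <> 0 by apply/eqP; rewrite QE.
rewrite (fpq _ VGx qx) PE QE mevalM rmorphXn /= mevalXU HPE // -/(norm (zc x)).
move: (zc x l) xl xN (P.@[_]) (Q.@[_]) Qx => t t0 tN a b b0.
rewrite exprS; move: (t ^+ m) (t ^+ N) tN => u v v0.
by field; rewrite b0 t0 v0.
Qed.

(** The coordinates are themselves invariant sections of degree 1, and where they all vanish so does
    every invariant of positive degree. *)
Lemma semistableP x :
  semistable h w x <-> schubert x /\ exists j, zc x j != 0.
Proof.
split=> [[Sx [m m0 [s [sL sT] sx]]]|[Sx [j zj]]].
  split=> //; have [i zi] : exists i, zv h x i != 0.
    apply/not_existsP => H; apply: sx.
    apply: (invariant_vanish h_unit sL sT (saturated_schubert h w).1) => // i.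
    by apply/eqP/negPn/negP; exact: H.
  exact: (zv_nonzero h_unit Sx zi).
split=> //; exists 1 => //.
have Xh : 'X_j \is [in C[d], 1.-homog] by rewrite dhomogX /= mdeg1.
exists (fun g => ('X_j : {mpoly C[d]}).@[zc g]).
  exact: homog_invariant_section.
by rewrite mevalXU; apply/eqP.
Qed.

Lemma vanishing_ideal_proportional x x' c : schubert x -> schubert x' -> c != 0 ->
  (exists j, zc x j != 0) -> (forall j, zc x' j = c * zc x j) ->
  vanishing_ideal h w x = vanishing_ideal h w x'.
Proof.
move=> Sx Sx' c0 x0 xE; apply: funext => m; apply: funext => s; apply: propext.
have key : invariant_section h w m s -> s x' = c ^+ m * s x.
  by move=> [sL sT]; apply: (comparison h_unit sL sT _ (saturated_schubert h w)).
split=> -[si sx]; split=> //; first by rewrite key // sx mulr0.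
by apply/eqP; have := sx; rewrite key // => /eqP; rewrite mulf_eq0 expf_eq0 (negPf c0) andbF.
Qed.

(** Degree 1 suffices: the linear forms z_l(x) z_j - z_j(x) z_l vanish at x, hence at x'. *)
Lemma vanishing_ideal_inj x x' : semistable h w x -> semistable h w x' ->
  vanishing_ideal h w x = vanishing_ideal h w x' ->
  exists2 c, c != 0 & forall j, zc x' j = c * zc x j.
Proof.
move=> /semistableP[Sx [l xl]] /semistableP[Sx' [l' xl']] E.
have key j : zc x l * zc x' j = zc x j * zc x' l.
  pose P : {mpoly C[d]} := zc x l *: 'X_j - zc x j *: 'X_l.
  have Xh i : 'X_i \is [in C[d], 1.-homog] by rewrite dhomogX /= mdeg1.
  have Ph : P \is 1.-homog by rewrite rpredB // dhomogZ.
  have : vanishing_ideal h w x 1 (fun g => P.@[zc g]).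
    split; first exact: homog_invariant_section.
    by rewrite mevalB !mevalZ !mevalXU mulrC subrr.
  rewrite E => -[_ /eqP]; rewrite mevalB !mevalZ !mevalXU subr_eq0 => /eqP //.
exists (zc x' l / zc x l); last first.
  by move=> j; apply: (mulfI xl); rewrite key; field.
rewrite mulf_neq0 ?invr_eq0 //; apply: contraNneq xl' => x'l.
by have /eqP := key l'; rewrite x'l mulr0 mulf_eq0 (negPf xl).
Qed.

Lemma git_point_eq (y y' : git_point h w) : sval y = sval y' -> y = y'.
Proof. by case: y y' => [y Py] [y' Py'] /= E; apply: eq_exist. Qed.

Lemma lies_over_exists (y : git_point h w) : exists x, lies_over x y.
Proof. by case: y => y [x sx yE]; exists x. Qed.

Lemma lies_over_uniq x (y y' : git_point h w) : lies_over x y -> lies_over x y' -> y = y'.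
Proof. by move=> [_ E] [_ E']; apply: git_point_eq; rewrite E E'. Qed.

Lemma semistable_lies_over x : semistable h w x -> exists y : git_point h w, lies_over x y.
Proof.
move=> sx; exists (exist _ (vanishing_ideal h w x) (ex_intro2 _ _ x sx erefl)).
by split.
Qed.

Lemma lies_over_proportional x x' c (y : git_point h w) : lies_over x y ->
  schubert x' -> c != 0 -> (forall j, zc x' j = c * zc x j) -> lies_over x' y.
Proof.
move=> [/semistableP[Sx [j xj]] yE] Sx' c0 xE; split.
  by apply/semistableP; split=> //; exists j; rewrite xE mulf_neq0.
by rewrite yE; apply: (vanishing_ideal_proportional Sx Sx' c0) => //; exists j.
Qed.

Lemma saturated_git_preimage (U : set (git_point h w)) : saturated h w (git_preimage U).
Proof.
split=> [x [y _ [[]]] //|g g' c [y Uy gy] Sg' c0 _ zE].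
by exists y => //; apply: (lies_over_proportional gy Sg' c0).
Qed.

End LocalForm.

(** * The section ring *)

Section Descent.
Variables (C : numClosedFieldType) (n0 : nat).
Local Notation n := n0.+2.
Variables (h : 'M[C]_n) (h_unit : h \in unitmx) (w : 'S_n).
Variable M : line_bundle (git_quotient h w).
Implicit Types (x : 'M[C]_n) (y : git_point h w) (i j : chart M) (p : chart_point M).
Local Notation schubert := (schubert h w).
Local Notation d := (zdim w).
Local Notation zc := (zcoord h (w:=w)).
Local Notation dom := Defs.dom.
Local Notation V i := (git_preimage (dom i : set (git_point h w))).

Variable s : chart M -> 'M[C]_n -> C.
Hypothesis s_section : forall i,
  [/\ L_section h (V i) 1 (s i), T_invariant h (V i) (s i)
    & forall x, V i x -> s i x <> 0].
Hypothesis s_trans : forall i j x y, dom i y -> dom j y -> lies_over x y ->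
  s i x = trans i j y * s j x.

Lemma s_neq0 i x y : dom i y -> lies_over x y -> s i x != 0.
Proof. by move=> iy xy; apply/eqP; have [_ _] := s_section i; apply; exists y. Qed.

Lemma s_proportional i x x' y c : dom i y -> lies_over x y -> lies_over x' y ->
  c != 0 -> (forall l, zc x' l = c * zc x l) -> s i x' = c * s i x.
Proof.
move=> iy xy x'y c0 xE; have [sL sT _] := s_section i.
have satV := saturated_git_preimage h_unit (dom i : set (git_point h w)).
rewrite -[c in RHS]expr1; apply: (comparison h_unit sL sT satV.1 satV) => //.
- by exists y.
- by exists y.
- by have [/(semistableP h_unit)[]] := xy.
Qed.

Definition representative p : 'M[C]_n := sval (cid (lies_over_exists (sval p).2)).

Lemma representativeP p : lies_over (representative p) (sval p).2.
Proof. by rewrite /representative; case: cid. Qed.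

(** The coordinates [z] of the point, trivialized by the local frame. *)
Definition rho p (l : 'I_d) : C := zc (representative p) l / s (sval p).1 (representative p).

(** Numerator and frame both have degree 1 in z, so the choice of a representative cancels. *)
Lemma rhoE p x : lies_over x (sval p).2 -> rho p = fun l => zc x l / s (sval p).1 x.
Proof.
move=> xy; have ry := representativeP p; have iy : dom (sval p).1 (sval p).2 := svalP p.
have [c c0 xE] : exists2 c, c != 0 & forall l, zc x l = c * zc (representative p) l.
  apply: (vanishing_ideal_inj h_unit) => //; [exact: ry.1|exact: xy.1|].
  by rewrite -ry.2 xy.2.
apply: funext => l; rewrite /rho xE (s_proportional iy ry xy c0 xE).
by rewrite -mulf_div divff // mul1r.
Qed.

Lemma meval_rho m (P : {mpoly C[d]}) p x : P \is m.-homog ->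
  lies_over x (sval p).2 -> P.@[rho p] = P.@[zc x] / s (sval p).1 x ^+ m.
Proof.
move=> Ph xy; rewrite (rhoE xy) mulrC -exprVn -(meval_homog _ _ Ph).
by congr (P.@[_]); apply: funext => l; rewrite mulrC.
Qed.

Lemma homog_bundle_section m (P : {mpoly C[d]}) : P \is m.-homog ->
  exists2 phi, bundle_section (M := M) m phi &
    forall p, P.@[rho p] = phi (sval p).1 (sval p).2.
Proof.
move=> Ph; pose phi i y : C :=
  if pselect (dom i y) is left iy
  then P.@[rho (exist (fun q : chart M * git_point h w => dom q.1 q.2) (i, y) iy)] else 0.
have phiE i y x : dom i y -> lies_over x y -> phi i y = P.@[zc x] / s i x ^+ m.
  by move=> iy xy; rewrite /phi; case: pselect => // iy'; apply: meval_rho.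
exists phi; last first.
  move=> p; have ry := representativeP p.
  by rewrite (phiE _ _ _ (svalP p) ry) (meval_rho Ph ry).
split; last first.
  move=> i j y iy jy; have [x xy] := lies_over_exists y.
  rewrite (phiE _ _ _ iy xy) (phiE _ _ _ jy xy) (s_trans iy jy xy).
  have s0 := s_neq0 jy xy; have := s_neq0 iy xy; rewrite (s_trans iy jy xy).
  rewrite mulf_eq0 negb_or => /andP[t0 _].
  rewrite exprMn; have := expf_neq0 m s0; have := expf_neq0 m t0.
  by move: (trans i j y ^+ m) (s j x ^+ m) => u v u0 v0; field; rewrite u0 v0.
move=> i y iy; have [x0 xy0] := lies_over_exists y.
have [sL sT _] := s_section i.
have satV := saturated_git_preimage h_unit (dom i : set (git_point h w)).
have Vx0 : V i x0 by exists y.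
have [_ z0] := (semistableP h_unit w x0).1 xy0.1.
have [e [P1 [Q1 [P1h Q1h Q10 sE]]]] := local_homog_rational h_unit satV sL sT Vx0 z0.
(* With the frame locally P1/Q1, the section P/s^m is P Q1^m / P1^m. One more Q1 on both sides
   ensures that Q1 is nonzero wherever the denominator is, so that the local formula applies
   there. *)
pose a := P * Q1 ^+ m.+1; pose b := P1 ^+ m * Q1.
have ah : a \is (m + e * m.+1).-homog by apply: dhomogM => //; apply: dhomogMn.
have bh : b \is (m + e * m.+1).-homog.
  have -> : (m + e * m.+1 = (1 + e) * m + e)%N by lia.
  by apply: dhomogM => //; apply: dhomogMn.
exists (m + e * m.+1)%N, (fun g => a.@[zc g]), (fun g => b.@[zc g]).
have P10 x : V i x -> Q1.@[zc x] != 0 -> P1.@[zc x] != 0.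
  move=> [y' iy' xy'] Qx; apply: contraNneq (s_neq0 iy' xy') => Px.
  by rewrite sE ?Px ?mul0r //; exists y'.
split; first exact: homog_invariant_section.
  split; first exact: homog_invariant_section.
  rewrite xy0.2 => -[_]; apply/eqP; rewrite mevalM rmorphXn /=.
  by apply: mulf_neq0 => //; apply: expf_neq0; apply: P10.
move=> y' x iy' [_ by'] xy'; have Vx : V i x by exists y'.
have : b.@[zc x] != 0.
  apply/eqP => bx; apply: by'; rewrite xy'.2; split=> //.
  exact: homog_invariant_section.
rewrite /a /b !mevalM !rmorphXn /= mulf_eq0 negb_or => /andP[_ Qx].
rewrite (phiE _ _ _ iy' xy') sE //; have Px := P10 _ Vx Qx.
rewrite expr_div_n exprS; have := expf_neq0 m Qx; have := expf_neq0 m Px.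
move: (P1.@[_] ^+ m) (Q1.@[_] ^+ m) => u v u0 v0.
by field; rewrite u0 v0 Qx.
Qed.

(** The product of [phi i] and the m-th power of the frame depends neither on the chart nor on the
    point over a given z. It is a homogeneous function of degree m on nonzero z, locally rational,
    hence a form. *)
Lemma bundle_section_homog m phi : bundle_section (M := M) m phi ->
  exists2 P : {mpoly C[d]}, P \is m.-homog &
    forall p, phi (sval p).1 (sval p).2 = P.@[rho p].
Proof.
move=> [phi_reg phi_trans].
have val_uniq x x' y y' i i' : zc x = zc x' -> lies_over x y -> lies_over x' y' ->
    dom i y -> dom i' y' -> phi i y * s i x ^+ m = phi i' y' * s i' x' ^+ m.
  move=> zxx' xy xy' iy iy'.
  have [Sx _] := (semistableP h_unit w x).1 xy.1.
  have [Sx' _] := (semistableP h_unit w x').1 xy'.1.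
  have x'y : lies_over x' y.
    apply: (lies_over_proportional h_unit xy Sx' (oner_neq0 C)) => l.
    by rewrite mul1r zxx'.
  have yy' := lies_over_uniq xy' x'y; rewrite yy' in iy' xy' *.
  rewrite (phi_trans i i' y iy iy') (s_trans iy iy' xy) exprMn.
  rewrite (@s_proportional i' x x' y 1) ?oner_neq0 //; last by move=> l; rewrite mul1r zxx'.
  by rewrite mul1r; ring.
have [Phi PhiE] : {Phi : ('I_d -> C) -> C & forall z x y i, zc x = z ->
    lies_over x y -> dom i y -> Phi z = phi i y * s i x ^+ m}.
  apply: cid; have : forall z, exists c, forall x y i, zc x = z ->
      lies_over x y -> dom i y -> c = phi i y * s i x ^+ m.
    move=> z; have [[x [y [i [xz xy iy]]]]|H] :=
        pselect (exists x y i, [/\ zc x = z, lies_over x y & dom i y]).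
      by exists (phi i y * s i x ^+ m) => x' y' i' x'z *; apply: val_uniq => //; rewrite xz.
    (* A default value, reached only at z = 0, over which no semistable point lies. *)
    by exists 0 => x y i xz xy iy; case: H; exists x, y, i.
  by move=> /choice[Phi PhiE]; exists Phi.
have point z : (exists l, z l != 0) -> exists x y i,
    [/\ zc x = z, schubert x, lies_over x y & dom i y].
  move=> z0; have [x Sx xz] := zc_surjective h_unit z0.
  have [y xy] : exists y, lies_over x y.
    by apply: semistable_lies_over; apply/(semistableP h_unit); rewrite xz.
  by have [i iy] := @dom_cover _ _ M y; exists x, y, i.
have Phi_homog c z : c != 0 -> (exists l, z l != 0) ->
    Phi (fun l => c * z l) = c ^+ m * Phi z.
  move=> c0 z0; have [x [y [i [xz Sx xy iy]]]] := point z z0.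
  have [|x' Sx' xz'] := @zc_surjective _ _ h h_unit w (fun l => c * z l).
    by have [l zl] := z0; exists l; rewrite mulf_neq0.
  have xE l : zc x' l = c * zc x l by rewrite xz' xz.
  have x'y := lies_over_proportional h_unit xy Sx' c0 xE.
  rewrite (PhiE _ _ _ _ xz' x'y iy) (PhiE _ _ _ _ xz xy iy).
  by rewrite (s_proportional iy xy x'y c0 xE) exprMn; ring.
have Phi_rat (l : 'I_d) z0 : z0 l = 1 -> exists P Q : {mpoly C[d]}, Q.@[z0] != 0 /\
    forall z, z l = 1 -> Q.@[z] != 0 -> Phi z = P.@[z] / Q.@[z].
  move=> z0l; have z0n : exists l, z0 l != 0 by exists l; rewrite z0l oner_eq0.
  have [x0 [y0 [i [xz Sx xy iy]]]] := point z0 z0n.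
  rewrite -xz in z0n.
  have [m' [a [b [aI [bI b0] phiE]]]] := phi_reg i y0 iy.
  have [m'' [t [_ [tI t0] tdom]]] := @dom_open _ _ M i y0 iy.
  have [sL sT _] := s_section i.
  have satV := saturated_git_preimage h_unit (dom i : set (git_point h w)).
  have satS := saturated_schubert h w.
  have Vx0 : V i x0 by exists y0.
  have [ea [Pa [Qa [_ _ Qa0 aE]]]] := local_homog_rational h_unit satS aI.1 aI.2 Sx z0n.
  have [eb [Pb [Qb [_ _ Qb0 bE]]]] := local_homog_rational h_unit satS bI.1 bI.2 Sx z0n.
  have [et [Pt [Qt [_ _ Qt0 tE]]]] := local_homog_rational h_unit satS tI.1 tI.2 Sx z0n.
  have [es [Ps [Qs [_ _ Qs0 sE]]]] := local_homog_rational h_unit satV sL sT Vx0 z0n.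
  have nz (u : 'M[C]_n -> C) k (Pu Qu : {mpoly C[d]}) : invariant_section h w k u ->
      ~ sval y0 k u -> Qu.@[zc x0] != 0 ->
      (forall x, schubert x -> Qu.@[zc x] != 0 -> u x = Pu.@[zc x] / Qu.@[zc x]) ->
      Pu.@[zc x0] != 0.
    move=> uI u0 Qu0 uE; apply/eqP => Pu0; apply: u0; rewrite xy.2; split=> //.
    by rewrite uE // Pu0 mul0r.
  have Pb0 := nz _ _ _ _ bI b0 Qb0 bE; have Pt0 := nz _ _ _ _ tI t0 Qt0 tE.
  (* Multiplying numerator and denominator by [D] changes no value but forces all local formulas to
     hold and t to be nonzero, which keeps the point in the chart [i]. *)
  pose D := Qb * Qs * Qt * Pt.
  exists (Pa * Qb * Ps ^+ m * D), (Qa * Pb * Qs ^+ m * D); rewrite -xz; split.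
    by rewrite /D !mevalM rmorphXn /= !mulf_eq0 !negb_or Qa0 Pb0 expf_neq0 // Qb0 Qs0 Qt0.
  move=> z zl; rewrite /D !mevalM !rmorphXn /= !mulf_eq0 !negb_or.
  case/andP=> /andP[/andP[Qaz Pbz] Qsm] /andP[/andP[/andP[Qbz Qsz] Qtz] Ptz].
  have [x [y [_ [zx Sx' xy' _]]]] : exists x y j,
      [/\ zc x = z, schubert x, lies_over x y & dom j y].
    by apply: point; exists l; rewrite zl oner_eq0.
  rewrite -zx in Qaz Pbz Qsm Qbz Qsz Qtz Ptz *.
  have nzx (u : 'M[C]_n -> C) k : invariant_section h w k u -> u x != 0 -> nonzero_at k u y.
    by move=> uI ux; split=> //; rewrite xy'.2 => -[_ u0]; rewrite u0 eqxx in ux.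
  have iy' : dom i y.
    apply: tdom; apply: nzx => //; rewrite tE //.
    by apply: mulf_neq0; rewrite ?invr_eq0.
  rewrite (PhiE _ _ _ _ erefl xy' iy') (phiE y x iy' _ xy'); last first.
    by apply: nzx => //; rewrite bE //; apply: mulf_neq0; rewrite ?invr_eq0.
  rewrite aE // bE // sE //; last by exists y.
  rewrite expr_div_n.
  move: (Pa.@[_]) (Qa.@[_]) Qaz (Pb.@[_]) Pbz => A1 A2 A20 B1 B10.
  move: (Qb.@[_]) Qbz (Ps.@[_] ^+ m) => B2 B20 S1.
  move: (Qs.@[_]) Qsz (Qt.@[_]) Qtz (Pt.@[_]) Ptz => S2 S20 T2 T20 T1 T10.
  have := expf_neq0 m S20; move: (S2 ^+ m) => S3 S30.
  by field; rewrite A20 B10 B20 S20 S30 T20 T10.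
have [P Ph PE] := homogeneous_locally_rational Phi_homog Phi_rat.
exists P => // p; have ry := representativeP p.
have [_ z0] := (semistableP h_unit w _).1 ry.1.
rewrite (meval_rho Ph ry) -PE // (PhiE _ _ _ _ erefl ry (svalP p)) mulfK //.
by apply: expf_neq0; apply: s_neq0 (svalP p) ry.
Qed.

Definition theta (P : {mpoly C[d]}) : chart_point M -> {poly C} :=
  fun p => graded_eval (rho p) P.

Lemma section_ring_theta P : section_ring (theta P).
Proof.
split=> [|m].
  exists (msize P) => p; apply/leq_sizeP => m le_m.
  rewrite coef_graded_eval pihomogE big_seq_cond big1 ?meval0 // => m' /andP[m'P].
  by move=> /eqP E; have := msize_mdeg_lt m'P; rewrite E ltnNge le_m.
have [phi phiS phiE] := homog_bundle_section (pihomogP mdeg m P).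
by exists phi => // p; rewrite coef_graded_eval phiE.
Qed.

Lemma section_ring_onto F : section_ring (M := M) F -> exists P, F = theta P.
Proof.
move=> [[N sF] Fm].
have : forall m, exists P : {mpoly C[d]}, P \is m.-homog /\ forall p, (F p)`_m = P.@[rho p].
  move=> m; have [phi phiS FE] := Fm m; have [P Ph PE] := bundle_section_homog phiS.
  by exists P; split=> // p; rewrite FE PE.
move=> /choice[Q QE]; exists (\sum_(m < N) Q m); apply: funext => p.
apply/polyP => m; rewrite coef_graded_eval.
have E (k : 'I_N) : pihomog mdeg m (Q k) = if m == k then Q k else 0.
  case: eqP => [->|/eqP mk]; first exact/pihomog_dE/(QE k).1.
  by apply: pihomog_ne0 (QE k).1; rewrite eq_sym.
rewrite [pihomog _ _ _]linear_sum /= (eq_bigr _ (fun k _ => E k)) -big_mkcond /=.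
have [lt_mN|le_Nm] := ltnP m N.
  by rewrite (big_pred1 (Ordinal lt_mN)) ?(QE m).2 // => k; rewrite -val_eqE eq_sym.
rewrite big_pred0 ?meval0; last by move=> k; rewrite gtn_eqF // (leq_trans (ltn_ord k)).
exact: (leq_sizeP _ _ (sF p)).
Qed.

Lemma rho_surjective (z : 'I_d -> C) : (exists l, z l != 0) ->
  exists p c, z = fun l => c * rho p l.
Proof.
move=> z0; have [x Sx xz] := zc_surjective h_unit z0.
have [y xy] : exists y, lies_over x y.
  by apply: semistable_lies_over; apply/(semistableP h_unit); rewrite xz.
have [i iy] := @dom_cover _ _ M y.
exists (exist (fun q : chart M * git_point h w => dom q.1 q.2) (i, y) iy), (s i x).
apply: funext => l; rewrite (@rhoE _ x) //= xz mulrC divfK //.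
exact: s_neq0 iy xy.
Qed.

(** Each homogeneous component vanishes at the points [rho p], hence on all their multiples, and
    these fill the affine space. *)
Lemma theta_eq0 P : (exists p : chart_point M, True) -> theta P = (fun=> 0) -> P = 0.
Proof.
move=> [p0 _] tP; apply: mpoly_fun_eq0 => z.
have P0 p c : P.@[fun l => c * rho p l] = 0.
  rewrite (@pihomog_partitionE _ _ mdeg _ P (leqnn _)) raddf_sum /= big1 // => k _.
  rewrite (meval_homog _ _ (pihomogP _ _ _)) -coef_graded_eval.
  by rewrite -/(theta P p) tP coef0 mulr0.
have [/rho_surjective[p [c ->]]|z0] := pselect (exists l, z l != 0); first exact: P0.
have -> : z = fun l => 0 * rho p0 l; last exact: P0.
by apply: funext => l; rewrite mul0r; apply/eqP/negPn/negP => zl; apply: z0; exists l.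
Qed.

Lemma thetaE P p : theta P p = graded_eval (rho p) P. Proof. by []. Qed.

Lemma theta_integral A B : integral_fraction (section_ring (M := M)) (theta A) (theta B) ->
  (exists p : chart_point M, True) -> integral_fraction setT A B.
Proof.
move=> [k [c [cS AE]]] p0.
have [c' c'E] := choice (fun i : 'I_k => section_ring_onto (cS i)).
exists k, c'; split=> //; apply/eqP; rewrite -subr_eq0; apply/eqP/theta_eq0 => //.
apply: funext => p; have := congr1 (fun F => F p) AE.
rewrite exprfctE fct_sumE !thetaE => E.
rewrite rmorphB rmorphXn rmorph_sum /= E; apply/eqP; rewrite subr_eq0; apply/eqP.
apply: eq_bigr => i _; rewrite !rmorphM !rmorphXn /=.
by rewrite c'E !mulrfctE !exprfctE !thetaE.
Qed.

(** [theta] identifies the polynomial ring in [zdim w] variables with the section ring. The domain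
    property and normality are carried over, and the variables become generators of degree 1. *)
Lemma projectively_normal_of_local_frames :
  semistable h w !=set0 -> projectively_normal M.
Proof.
move=> [x0 sx0]; have [y0 _] := semistable_lies_over sx0.
have [i0 iy0] := @dom_cover _ _ M y0.
have p0 : exists p : chart_point M, True.
  by exists (exist (fun q : chart M * git_point h w => dom q.1 q.2) (i0, y0) iy0).
have [p1 _] := p0.
split; first split; first split.
- by move=> /(congr1 (fun F => F p1)) /eqP; rewrite oner_eq0.
- move=> _ _ /section_ring_onto[A ->] /section_ring_onto[B ->] AB.
  have /eqP : A * B = 0.
    apply: theta_eq0 => //; apply: funext => p; have := congr1 (fun F => F p) AB.
    by rewrite mulrfctE !thetaE rmorphM.
  by rewrite mulf_eq0 => /orP[] /eqP ->; [left|right]; apply: funext => p; rewrite thetaE rmorph0.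
- move=> _ _ /section_ring_onto[A ->] /section_ring_onto[B ->] B0 int.
  have [|q _ ->] := mpoly_integral_dvd _ (theta_integral int p0).
    by apply/eqP => B0'; apply: B0; apply: funext => p; rewrite thetaE B0' rmorph0.
  exists (theta q); first exact: section_ring_theta.
  by apply: funext => p; rewrite mulrfctE !thetaE rmorphM.
move=> D [D1 DB DM] DC DE _ /section_ring_onto[P ->].
have D0 : D 0 by rewrite -(subrr 1); apply: DB.
have DD a b : D a -> D b -> D (a + b).
  by move=> Da Db; rewrite -(opprK b); apply: (DB) => //; rewrite -sub0r; apply: DB.
have DX (i : 'I_d) : D (theta 'X_i).
  have tX p : theta 'X_i p = rho p i *: 'X.
    by rewrite thetaE /graded_eval mmapX mmap1U.
  apply: DE; split; first exact: section_ring_theta.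
  by move=> p; rewrite tX coefZ coefX mulr1.
have DXm m : D (theta 'X_[m]).
  have -> : theta 'X_[m] = \prod_(i < d) theta 'X_i ^+ m i.
    apply: funext => p; rewrite thetaE mpolyXE_id rmorph_prod /=.
    elim/big_ind2: _ => [//|a F1 b F2 -> -> //|i _].
    by rewrite rmorphXn exprfctE thetaE.
  apply: (big_ind D) => // i _.
  by elim: (m i) => [|k IHk]; rewrite ?expr0 // exprS; apply: DM.
elim/mpolyind: P => [|c m P _ _ DP].
  rewrite (_ : theta 0 = 0) //; apply: funext => p; rewrite thetaE rmorph0 //.
rewrite (_ : theta _ = (fun=> c%:P) * theta 'X_[m] + theta P).
  by apply: (DD) => //; apply: (DM) => //; apply: DC; exists c.
apply: funext => p; rewrite addrfctE mulrfctE !thetaE rmorphD /= -mul_mpolyC rmorphM /=.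
by rewrite /graded_eval mmapC.
Qed.

End Descent.

Theorem theorem5p1 (R : realType) (n : nat) (hn : (1 < n)%N)
    (h : 'M[R[i]]_n) (hh : h \in unitmx)
    (w : 'S_n) (hw : min_length_rep R[i] w)
    (hss : semistable h w !=set0)
    (M : line_bundle (git_quotient h w)) (hM : is_descent M) :
  projectively_normal M.
Proof.
case: n hn h hh w hw hss M hM => [|[|n]] // _ h hh w _ hss M [s [sS sT]].
exact: (projectively_normal_of_local_frames hh sS sT).
Qed.
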